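(* The zero locus in $OG(2,10)$ of a general global section of $\mathcal{S}_+\oplus\mathcal{S}_-$ is isomorphic to $Fl_4$.
   Context: Over $\mathbb{C}$. $OG(2,10)$ is the orthogonal Grassmannian of isotropic planes $U$ in $V=\mathbb{C}^{10}$ with a non-degenerate quadratic form. Write $V=E\oplus F$ with $E,F$ maximal isotropic, $F\simeq E^\vee$. The half-spin representations of $Spin_{10}$ are $\Delta_+=\wedge^{even}E$, $\Delta_-=\wedge^{odd}E$, with Clifford action $V\otimes\Delta_\pm\to\Delta_\mp$ ($E$ acts by wedge product, $F$ by contraction). The spinor bundle $\mathcal{S}_\pm$ on $OG(2,10)$ is the homogeneous bundle of rank $4$ whose fiber at $[U]$ is the cokernel of $U\otimes\Delta_\mp\to\Delta_\pm$; $H^0(\mathcal{S}_\pm)=\Delta_\pm$. $Fl_n$ denotes the adjoint variety of $SL_n$, i.e. the incidence variety of pairs (point, hyperplane containing it) in $\mathbb{P}^{n-1}\times\check{\mathbb{P}}^{n-1}$. *)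

(* Defs.v *)
From HB Require Import structures.
From mathcomp Require Import all_boot all_order all_algebra.
From mathcomp Require Import boolp classical_sets.
From mathcomp Require Import mpoly.
From mathcomp Require Import ring.

Set Implicit Arguments.
Unset Strict Implicit.
Unset Printing Implicit Defensive.

Import GRing.Theory.
Local Open Scope classical_set_scope.
Local Open Scope ring_scope.

(* By Yoneda's lemma, k-schemes form a full subcategory of these functors: two
   k-schemes are isomorphic if and only if their functors of points are. *)
Record functor_of_points (k : fieldType) := FunctorOfPoints {
  points :> comAlgType k -> Type;
  pull : forall A B : comAlgType k, {lrmorphism A -> B} -> points A -> points B;
  pull_id : forall (A : comAlgType k) (x : points A), pull idfun x = x;
  pull_comp : forall (A B D : comAlgType k)
    (f : {lrmorphism A -> B}) (g : {lrmorphism B -> D}) (x : points A),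
    pull (g \o f) x = pull g (pull f x) }.

Definition isomorphic (k : fieldType) (X Y : functor_of_points k) : Prop :=
  exists F : forall A : comAlgType k, X A -> Y A,
    (forall A : comAlgType k, bijective (F A)) /\
    (forall (A B : comAlgType k) (f : {lrmorphism A -> B}) (x : X A),
       F B (pull f x) = pull f (F A x)).

Definition linspan (A : nzRingType) (M : lmodType A) (S : set M) : set M :=
  [set w | exists (m : nat) (c : 'I_m -> A) (x : 'I_m -> M),
     (forall i, S (x i)) /\ w = \sum_i c i *: x i].

Definition rowspace (A : nzRingType) (n : nat) (e : 'M[A]_n) : set 'rV[A]_n :=
  [set v *m e | v in [set: 'rV[A]_n]].

(* U is a direct summand of A^n (that is, the image of a projector e), and it
   has rank r at every field-valued point of Spec A.  Such U are the A-points of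
   the Grassmannian G(r, n). *)
Definition subbundle (A : comNzRingType) (n r : nat) (U : set 'rV[A]_n) : Prop :=
  exists e : 'M[A]_n,
    [/\ e *m e = e, U = rowspace e &
        forall (K : fieldType) (f : {rmorphism A -> K}), \rank (map_mx f e) = r].

(* For a direct summand U, this is the image of the tensor product of U with B. *)
Definition base_change (A B : comNzRingType) (f : {rmorphism A -> B}) (n : nat)
  (U : set 'rV[A]_n) : set 'rV[B]_n := linspan (map_mx f @` U).

Lemma linspan_sub (A : nzRingType) (M : lmodType A) (S : set M) : S `<=` linspan S.
Proof.
move=> x Sx; exists 1, (fun=> 1), (fun=> x); split => //.
by rewrite big_ord1 scale1r.
Qed.

Lemma base_change_rowspace (A B : comNzRingType) (f : {rmorphism A -> B})
  (n : nat) (e : 'M[A]_n) :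
  base_change f (rowspace e) = rowspace (map_mx f e).
Proof.
apply/seteqP; split => w.
  move=> [m [c [x [Sx ->]]]].
  have Hx i : exists v : 'rV[B]_n, v *m map_mx f e = x i.
    case: (Sx i) => _ [v _ <-] <-; exists (map_mx f v).
    by rewrite map_mxM.
  have [y Hy] := choice Hx.
  exists (\sum_i c i *: y i) => //.
  by rewrite mulmx_suml; apply: eq_bigr => i _; rewrite -scalemxAl Hy.
move=> [v _ <-].
exists n, (fun i => v 0 i), (fun i => map_mx f (row i e)); split.
  move=> i; exists (row i e) => //.
  by exists (delta_mx 0 i) => //; rewrite -rowE.
apply/rowP => j; rewrite mxE summxE; apply: eq_bigr => i _.
by rewrite !mxE.
Qed.

Lemma base_change_subbundle (A B : comNzRingType) (f : {rmorphism A -> B})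
  (n r : nat) (U : set 'rV[A]_n) :
  subbundle r U -> subbundle r (base_change f U).
Proof.
move=> [e [ee -> rk]]; exists (map_mx f e); split.
- by rewrite -map_mxM ee.
- exact: base_change_rowspace.
- by move=> K g; rewrite -map_mx_comp; exact: (rk K (g \o f)).
Qed.

Lemma base_change_id (A : comNzRingType) (n r : nat) (U : set 'rV[A]_n) :
  subbundle r U -> base_change idfun U = U.
Proof.
by move=> [e [_ -> _]]; rewrite base_change_rowspace map_mx_id.
Qed.

Lemma base_change_comp (A B D : comNzRingType) (f : {rmorphism A -> B})
  (g : {rmorphism B -> D}) (n r : nat) (U : set 'rV[A]_n) : subbundle r U ->
  base_change (g \o f) U = base_change g (base_change f U).
Proof.
by move=> [e [_ -> _]]; rewrite !base_change_rowspace map_mx_comp.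
Qed.

Lemma base_change_subset (A B : comNzRingType) (f : {rmorphism A -> B})
  (n : nat) (U W : set 'rV[A]_n) :
  U `<=` W -> base_change f U `<=` base_change f W.
Proof.
move=> UW w [m [c [x [Sx ->]]]]; exists m, c, x; split => // i.
by case: (Sx i) => u Uu <-; exists u => //; exact: UW.
Qed.

Section Flag.
Variables (k : fieldType) (n : nat).

Definition flag_pts (A : comAlgType k) : Type :=
  {LH : set 'rV[A]_n * set 'rV[A]_n |
    [/\ subbundle 1 LH.1, subbundle n.-1 LH.2 & LH.1 `<=` LH.2]}.

Program Definition flag_pull (A B : comAlgType k) (f : {lrmorphism A -> B})
    (x : flag_pts A) : flag_pts B :=
  exist _ (base_change f (sval x).1, base_change f (sval x).2) _.
Next Obligation.
case: x => -[L H] /= [sL sH LH]; split => /=.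
- exact: base_change_subbundle.
- exact: base_change_subbundle.
- exact: base_change_subset.
Qed.

Lemma flag_pull_id (A : comAlgType k) (x : flag_pts A) : flag_pull idfun x = x.
Proof.
case: x => -[L H] [sL sH LH]; apply: eq_exist => /=.
by rewrite (base_change_id sL) (base_change_id sH).
Qed.

Lemma flag_pull_comp (A B D : comAlgType k) (f : {lrmorphism A -> B})
  (g : {lrmorphism B -> D}) (x : flag_pts A) :
  flag_pull (g \o f) x = flag_pull g (flag_pull f x).
Proof.
case: x => -[L H] [sL sH LH]; apply: eq_exist => /=.
by rewrite (base_change_comp f g sL) (base_change_comp f g sH).
Qed.

Definition Fl : functor_of_points k := FunctorOfPoints flag_pull_id flag_pull_comp.

End Flag.

(* A vector of V is row_mx e f, with e in E and f in F = E^dual, both of them in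
   coordinates for dual bases. *)
Definition qform (A : comNzRingType) (v : 'rV[A]_(5 + 5)) : A :=
  \sum_(i < 5) lsubmx v 0 i * rsubmx v 0 i.

Definition qpolar (A : comNzRingType) (u v : 'rV[A]_(5 + 5)) : A :=
  \sum_(i < 5) (lsubmx u 0 i * rsubmx v 0 i + lsubmx v 0 i * rsubmx u 0 i).

Lemma qformD (A : comNzRingType) (u v : 'rV[A]_(5 + 5)) :
  qform (u + v) = qform u + qform v + qpolar u v.
Proof.
rewrite /qform /qpolar -!big_split; apply: eq_bigr => i _ /=; rewrite !mxE.
by ring.
Qed.

Lemma qpolarC (A : comNzRingType) (u v : 'rV[A]_(5 + 5)) : qpolar u v = qpolar v u.
Proof. by apply: eq_bigr => i _; rewrite addrC. Qed.

Lemma qpolarDl (A : comNzRingType) (u v w : 'rV[A]_(5 + 5)) :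
  qpolar (u + v) w = qpolar u w + qpolar v w.
Proof.
rewrite /qpolar -big_split; apply: eq_bigr => i _ /=; rewrite !mxE.
by ring.
Qed.

Lemma qpolarZl (A : comNzRingType) (a : A) (u w : 'rV[A]_(5 + 5)) :
  qpolar (a *: u) w = a * qpolar u w.
Proof.
rewrite /qpolar mulr_sumr; apply: eq_bigr => i _ /=; rewrite !mxE.
by ring.
Qed.

(* The exterior algebra of E: s I is the coefficient of the wedge product of
   the basis vectors e_i, i in I, taken in increasing order. *)
Notation spinor A := {ffun {set 'I_5} -> A^o}.

(* Delta_+ (even spinors) for b = false, Delta_- (odd spinors) for b = true *)
Definition half_spin (A : comNzRingType) (b : bool) : set (spinor A) :=
  [set s | forall I : {set 'I_5}, odd #|I| != b -> s I = 0].

Definition half_part (A : comNzRingType) (b : bool) (s : spinor A) : spinor A :=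
  [ffun I : {set 'I_5} => if odd #|I| == b then s I else 0].

(* e_i wedge e_(J :\ i) = (-1)^m e_J for i in J, and f_i contracts e_(i |: J) to
   (-1)^m e_J for i not in J, where m is the number of j < i in J. *)
Definition clifford (A : comNzRingType) (v : 'rV[A]_(5 + 5)) (s : spinor A) :
    spinor A :=
  [ffun J : {set 'I_5} => \sum_(i < 5) (-1) ^+ #|[set j in J | (j < i)%N]| *
     (if i \in J then lsubmx v 0 i * s (J :\ i) else rsubmx v 0 i * s (i |: J))].

Definition map_spinor (A B : comNzRingType) (f : {rmorphism A -> B})
  (s : spinor A) : spinor B := [ffun I => f (s I)].

Definition const_spinor (k : fieldType) (A : comAlgType k) (s : spinor k) :
  spinor A := [ffun I => (s I)%:A].

Definition isotropic_plane (A : comNzRingType) (U : set 'rV[A]_(5 + 5)) : Prop :=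
  subbundle 2 U /\ forall u, U u -> qform u = 0.

(* The image of the tensor product of U with Delta_-+ in Delta_+-, that is, the
   kernel of the map from Delta_+- to the fibre at U of the spinor bundle S_+-. *)
Definition clifford_image (A : comNzRingType) (b : bool)
    (U : set 'rV[A]_(5 + 5)) : set (spinor A) :=
  linspan [set clifford u t | u in U & t in half_spin (~~ b)].

Lemma map_clifford (A B : comNzRingType) (f : {rmorphism A -> B})
  (v : 'rV[A]_(5 + 5)) (s : spinor A) :
  map_spinor f (clifford v s) = clifford (map_mx f v) (map_spinor f s).
Proof.
apply/ffunP => J; rewrite !ffunE rmorph_sum; apply: eq_bigr => i _.
by rewrite rmorphM rmorphXn rmorphN1; congr (_ * _); case: ifP => _;
  rewrite rmorphM !mxE ffunE.
Qed.

Lemma map_const_spinor (k : fieldType) (A B : comAlgType k)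
  (f : {lrmorphism A -> B}) (s : spinor k) :
  map_spinor f (const_spinor A s) = const_spinor B s.
Proof.
apply/ffunP => I; rewrite !ffunE.
by have := linearZ_LR f (s I) 1; rewrite rmorph1.
Qed.

Lemma base_change_isotropic (A B : comNzRingType) (f : {rmorphism A -> B})
  (U : set 'rV[A]_(5 + 5)) :
  isotropic_plane U -> isotropic_plane (base_change f U).
Proof.
move=> [sU oU]; split; first exact: base_change_subbundle.
have UD u v : U u -> U v -> U (u + v).
  case: sU => e [_ -> _] [u' _ <-] [v' _ <-].
  by exists (u' + v') => //; rewrite mulmxDl.
have qf v : qform (map_mx f v) = f (qform v).
  rewrite /qform rmorph_sum; apply: eq_bigr => i _.
  by rewrite rmorphM !mxE.
have oB x y : (map_mx f @` U) x -> (map_mx f @` U) y -> qpolar x y = 0.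
  move=> [u Uu <-] [v Uv <-].
  have := qformD (map_mx f u) (map_mx f v).
  by rewrite -map_mxD !qf !oU ?rmorph0 ?add0r //; exact: UD.
move=> _ [m [c [x [Sx ->]]]].
suff [] : qform (\sum_i c i *: x i) = 0 /\
  forall y, (map_mx f @` U) y -> qpolar y (\sum_i c i *: x i) = 0 by [].
elim: m c x Sx => [|m IHm] c x Sx.
  rewrite big_ord0; split.
    by rewrite /qform big1 // => i _; rewrite !mxE mul0r.
  by move=> y _; rewrite /qpolar big1 // => i _; rewrite !mxE mulr0 mul0r addr0.
rewrite big_ord_recl.
have [] := IHm (fun i => c (lift ord0 i)) (fun i => x (lift ord0 i)) (fun i => Sx _).
set w := (\sum_(i < m) _) => qw bw; split.
  rewrite qformD qw qpolarZl bw // mulr0 !addr0 /qform.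
  have : qform (x ord0) = 0 by case: (Sx ord0) => u Uu <-; rewrite qf oU ?rmorph0.
  rewrite /qform => q0; rewrite -[RHS](mulr0 (c ord0 ^+ 2)) -[in RHS]q0 mulr_sumr.
  by apply: eq_bigr => i _; rewrite !mxE mulrACA expr2.
move=> y Sy; rewrite qpolarC qpolarDl qpolarZl qpolarC oB // mulr0 add0r.
by rewrite qpolarC bw.
Qed.

Lemma base_change_clifford_image (A B : comNzRingType) (f : {rmorphism A -> B})
  (b : bool) (U : set 'rV[A]_(5 + 5)) (s : spinor A) :
  clifford_image b U s -> clifford_image b (base_change f U) (map_spinor f s).
Proof.
move=> [m [c [x [Sx ->]]]].
exists m, (fun i => f (c i)), (fun i => map_spinor f (x i)); split.
  move=> i; case: (Sx i) => u Uu [t ht <-].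
  exists (map_mx f u); first by apply: linspan_sub; exists u.
  exists (map_spinor f t); last by rewrite map_clifford.
  by move=> I /ht tI; rewrite ffunE tI rmorph0.
apply/ffunP => I; rewrite !ffunE !sum_ffunE rmorph_sum.
by apply: eq_bigr => i _; rewrite !ffunE; exact: rmorphM.
Qed.

Section ZeroLocus.
Variables (k : fieldType) (sp sm : spinor k).

(* The zero locus of the section (sp, sm) of S_+ + S_-, with sp in Delta_+ and sm
   in Delta_-.  Cokernels commute with base change, so that these are the points
   of the zero scheme. *)
Definition zero_pts (A : comAlgType k) : Type :=
  {U : set 'rV[A]_(5 + 5) |
    [/\ isotropic_plane U, clifford_image false U (const_spinor A sp) &
        clifford_image true U (const_spinor A sm)]}.

Program Definition zero_pull (A B : comAlgType k) (f : {lrmorphism A -> B})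
    (x : zero_pts A) : zero_pts B :=
  exist _ (base_change f (sval x)) _.
Next Obligation.
case: x => U /= [oU Up Um]; split.
- exact: base_change_isotropic.
- by rewrite -(map_const_spinor f); exact: base_change_clifford_image.
- by rewrite -(map_const_spinor f); exact: base_change_clifford_image.
Qed.

Lemma zero_pull_id (A : comAlgType k) (x : zero_pts A) : zero_pull idfun x = x.
Proof.
case: x => U [[sU oU] Up Um]; apply: eq_exist => /=.
by rewrite (base_change_id sU).
Qed.

Lemma zero_pull_comp (A B D : comAlgType k) (f : {lrmorphism A -> B})
  (g : {lrmorphism B -> D}) (x : zero_pts A) :
  zero_pull (g \o f) x = zero_pull g (zero_pull f x).
Proof.
case: x => U [[sU oU] Up Um]; apply: eq_exist => /=.
by rewrite (base_change_comp f g sU).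
Qed.

Definition zero_locus : functor_of_points k :=
  FunctorOfPoints zero_pull_id zero_pull_comp.

End ZeroLocus.

(* Q holds on a nonempty Zariski open subset of the affine space k^I. *)
Definition general (k : fieldType) (I : finType) (Q : {ffun I -> k^o} -> Prop) :
    Prop :=
  exists P : {mpoly k[#|I|]},
    P != 0 /\ forall s : {ffun I -> k^o}, P.@[fun i => s (enum_val i)] != 0 -> Q s.

(* Main.v *)
(* A general pair of half-spinors can be brought, by transformations
   s |-> s + c x y s with x, y orthogonal isotropic vectors (each acts on V by an
   isometry), to the form (p1 + r1 e_0 e_1 e_2 e_3, (p2 + r2 e_0 e_1 e_2 e_3) e_4): one
   first clears coefficients of the odd half one at a time, and then diagonalizes
   the pencil formed by the two halves, which takes the square root of a
   discriminant.  All steps before that root are rational and defined at an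
   explicit spinor, so that they are defined on a nonempty open set.

   A point U of the zero locus kills both halves: u v s = 0 for u, v in U, because
   products of three vectors of U vanish.  For the normal form this says that
   all 2 x 2 minors of U vanish, except those with one column in
   E4 = <e_0, .., e_3> and one in F4 = <f_0, .., f_3>.  The latter minors then
   generate the unit ideal, hence U = L + M with lines L in E4 and M in F4,
   and the orthogonality of L and M puts L in the hyperplane H = M^perp of E4. *)
From HB Require Import structures.
Require Import Defs.
From mathcomp Require Import all_boot all_order all_fingroup all_algebra.
From mathcomp Require Import boolp classical_sets mpoly reals complex ring.

Set Implicit Arguments.
Unset Strict Implicit.
Unset Printing Implicit Defensive.

Import Order.TTheory GRing.Theory Num.Theory.
Local Open Scope classical_set_scope.
Local Open Scope ring_scope.

(** * Points with values in fields *)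

(** The isomorphism has to be given over every k-algebra A. There a plane U is known only through a
    projector e whose rank is prescribed at field-valued points: U need not have a basis, and A may
    contain zero divisors and nilpotents, so an identity that holds at all fields need not hold in
    A. Two devices replace local bases. For a vanishing or a membership to be proved, the scalars c
    such that c times the statement holds form an ideal; an ideal that lies in the kernel of no map
    to a field contains 1. For an expression that is alternating in more rows of e than the rank
    allows, averaging over permutations gives a linear system whose matrix is m! at every field,
    hence invertible; only m = 2 and m = 3 occur, so that 6 must not vanish. Conversely, a flag
    gives a zero of the section without any choice of generators: the identity \tr e = 1 for a
    projector of rank one does the work of a vector dual to a generator of the line. *)

Section ResidueField.
Variable A : comNzRingType.
Implicit Type J : set A.

Definition ideal J : Prop :=
  [/\ J 0, forall x y, J x -> J y -> J (x + y) & forall a x, J x -> J (a * x)].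

Definition proper J : Prop := ideal J /\ ~ J 1.

Lemma maximal_ideal J : proper J ->
  exists M : set A, [/\ proper M, J `<=` M &
    forall a, ~ M a -> exists b, M (1 - b * a)].
Proof.
move=> pJ.
pose P := [set M : set A | (proper M /\ J `<=` M) \/ M = set0].
have [|M [PM maxM]] := @Zorn_bigcup _ P.
  move=> F FP totF.
  have [F0|/existsNP[X0 /not_implyP[FX0 nX0]]] :=
      pselect (forall X, F X -> X = set0).
    by right; apply/seteqP; split=> // x [X FX]; rewrite (F0 X FX).
  have [[[[X00 X0D X0M] X01] JX0]|//] := FP _ FX0.
  left; split; last by move=> x /JX0 ?; exists X0.
  split; last first.
    move=> [X FX X1]; case: (FP _ FX) => [[[_ nX1] _]|XE] //.
    by move: X1; rewrite XE.
  split; first by exists X0.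
  - move=> x y [X FX Xx] [Y FY Yy].
    have [Z [FZ Zx Zy]] : exists Z, [/\ F Z, Z x & Z y].
      by case: (totF _ _ FX FY) => XY; [exists Y | exists X]; split => //; exact: XY.
    exists Z => //; case: (FP _ FZ) => [[[[_ ZD _] _] _]|ZE].
      exact: ZD.
    by move: Zx; rewrite ZE.
  - move=> a x [X FX Xx]; exists X => //.
    case: (FP _ FX) => [[[[_ _ XM] _] _]|XE]; first exact: XM.
    by move: Xx; rewrite XE.
have JP : P J by left; split.
have [[pM JM]|M0] := PM; last first.
  case: (maxM J) => //; rewrite M0 properEneq; split => //.
  by apply/eqP => J0; case: pJ => [[J00 _ _] _]; rewrite -J0 in J00.
exists M; split => // a nMa.
have [[M0 MD MM] M1] := pM.
pose N := [set y | exists x b, M x /\ y = x + b * a].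
have [N1|nN1] := pselect (N 1).
  case: N1 => x [b [Mx e1]]; exists b.
  by rewrite e1 addrK.
exfalso; apply: (maxM N).
  split; last first.
    move=> NM; apply: nMa; apply: NM.
    by exists 0, 1; rewrite add0r mul1r.
  by move=> x Mx; exists x, 0; rewrite mul0r addr0.
left; split; last first.
  by move=> x /JM Mx; exists x, 0; rewrite mul0r addr0.
split => //; split.
- by exists 0, 0; rewrite mul0r addr0.
- move=> _ _ [x [b [Mx ->]]] [y [c [My ->]]].
  exists (x + y), (b + c); split; first exact: MD.
  by ring.
- move=> c _ [x [b [Mx ->]]]; exists (c * x), (c * b); split; first exact: MM.
  by ring.
Qed.

Section Quotient.
Variables (M : set A) (pM : proper M).
Hypothesis maxM : forall a, ~ M a -> exists b, M (1 - b * a).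

Definition idealb (a : A) : bool := `[< M a >].

Lemma idealb_closed : idealr_closed idealb.
Proof.
case: pM => -[M0 MD MM] M1; split; first exact/asboolP.
- by apply/asboolP.
- move=> a x y /asboolP Mx /asboolP My; apply/asboolP.
  by apply: MD => //; exact: MM.
Qed.

HB.instance Definition _ := isIdealr.Build A idealb idealb_closed.

Local Notation Q := (Quotient.quot (idealb : idealr A)).
Local Open Scope quotient_scope.

Lemma quot_pi0 a : M a -> \pi_Q a = 0.
Proof.
move=> Ma; apply/eqP; rewrite -[0](rmorph0 (\pi_Q)) -Quotient.idealrBE subr0.
exact/asboolP.
Qed.

Lemma quot_inv_ex (x : Q) : x != 0 -> exists y : Q, y * x = 1.
Proof.
rewrite -[x]reprK; set a := generic_quotient.repr x => ax.
have nMa : ~ M a.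
  by move=> Ma; case/eqP: ax; exact: quot_pi0.
have [b Mb] := maxM nMa.
exists (\pi_Q b); rewrite -rmorphM -[1](rmorph1 (\pi_Q)).
apply/esym/eqP; rewrite -Quotient.idealrBE; exact/asboolP.
Qed.

Definition quot_inv (x : Q) : Q :=
  if pselect (x != 0) is left nx then projT1 (cid (quot_inv_ex nx)) else 0.

Lemma quot_mulVf (x : Q) : x != 0 -> quot_inv x * x = 1.
Proof.
move=> nx; rewrite /quot_inv; case: pselect => // nx'.
by case: cid.
Qed.

Lemma quot_inv0 : quot_inv 0 = 0.
Proof. by rewrite /quot_inv; case: pselect => // n0; case/eqP: {-}n0. Qed.

HB.instance Definition _ := GRing.ComNzRing_isField.Build Q quot_mulVf quot_inv0.

Lemma maximal_residue_field :
  exists (K : fieldType) (f : {rmorphism A -> K}), forall a, M a -> f a = 0.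
Proof.
exists (Q : fieldType), (\pi_Q : {rmorphism A -> Q}).
exact: quot_pi0.
Qed.

End Quotient.

Lemma residue_field J : proper J ->
  exists (K : fieldType) (f : {rmorphism A -> K}), forall a, J a -> f a = 0.
Proof.
move=> /maximal_ideal[M [pM JM maxM]].
have [K [f fM]] := maximal_residue_field pM maxM.
by exists K, f => a /JM; exact: fM.
Qed.

(** The passage from fields to A: a proper ideal lies in a maximal one and dies in its residue
    field. Below, [J] consists of the scalars c for which c times a desired statement holds. *)
Lemma ideal_unit J : ideal J ->
  (forall (K : fieldType) (f : {rmorphism A -> K}),
     ~ (forall a, J a -> f a = 0)) -> J 1.
Proof.
move=> iJ nJ; apply: contrapT => J1.
by have [|K [f /nJ]] := @residue_field J.
Qed.

Lemma invertible_at_fields (a : A) :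
  (forall (K : fieldType) (f : {rmorphism A -> K}), f a != 0) ->
  exists b, b * a = 1.
Proof.
move=> fa; pose J := [set x | exists b, b * a = x].
suff [b ba] : J 1 by exists b.
apply: ideal_unit; last first.
  move=> K f /(_ a) fa0; have /eqP := fa K f; apply.
  by apply: fa0; exists 1; rewrite mul1r.
split; first by exists 0; rewrite mul0r.
- by move=> _ _ [b <-] [c <-]; exists (b + c); rewrite mulrDl.
- by move=> c _ [b <-]; exists (c * b); rewrite mulrA.
Qed.

End ResidueField.

Lemma rank_le1_minors (K : fieldType) (m n : nat) (M : 'M[K]_(m, n)) :
  (forall i j k l, M i k * M j l = M i l * M j k) -> (\rank M <= 1)%N.
Proof.
move=> minM; have [->|/matrix0Pn[i [k Mik]]] := eqVneq M 0.
  by rewrite mxrank0.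
suff -> : M = (M i k)^-1 *: col k M *m row i M.
  by apply: leq_trans (mxrankM_maxl _ _) (rank_leq_col _).
apply/matrixP => j l; rewrite -scalemxAl !mxE big_ord1 !mxE [M j k * _]mulrC.
by rewrite -minM mulKf.
Qed.

Lemma rank_mxsub (K : fieldType) (m n p q : nat) (g : 'I_p -> 'I_m)
    (h : 'I_q -> 'I_n) (M : 'M[K]_(m, n)) : (\rank (mxsub g h M) <= \rank M)%N.
Proof.
have -> : mxsub g h M = rowsub g 1%:M *m (M *m colsub h 1%:M).
  by rewrite mul_rowsub_mx mul1mx mulmx_colsub mulmx1; apply/matrixP=> i j; rewrite !mxE.
by apply: leq_trans (mxrankM_maxr _ _) (mxrankM_maxl _ _).
Qed.

Lemma rank_idempotent_compl (K : fieldType) (n : nat) (M : 'M[K]_n) :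
  M *m M = M -> \rank (1%:M - M) = (n - \rank M)%N.
Proof.
move=> MM; apply/eqP; rewrite eqn_leq; apply/andP; split.
  rewrite -(leq_add2r (\rank M)) subnK ?rank_leq_row //.
  by apply: mulmx0_rank_max; rewrite mulmxBl mul1mx MM subrr.
rewrite leq_subLR -{1}(mxrank1 K n) -[X in \rank X](subrKC M 1%:M).
exact: mxrank_add.
Qed.

(** The adjugate turns the equation into [\det B *: T = 0], and [\det B] is a unit because it
    vanishes at no field. *)
Lemma nakayama (A : comNzRingType) (n : nat) (B : 'M[A]_n) (T : 'cV[A]_n) :
  (forall (K : fieldType) (f : {rmorphism A -> K}), map_mx f B \in unitmx) ->
  B *m T = 0 -> T = 0.
Proof.
move=> fB BT.
have [|b bB] := @invertible_at_fields A (\det B).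
  by move=> K f; rewrite -det_map_mx -unitfE -unitmxE; exact: fB.
by rewrite -[T]scale1r -bB -scalerA -(mul_scalar_mx (\det B)) -mul_adj_mx -mulmxA BT mulmx0 scaler0.
Qed.

(** * Alternating functions reproduced by a projector of small rank *)

Section Alternating.
Variables (A : comNzRingType) (n m : nat) (e : 'M[A]_n).
Hypothesis rk_e : forall (K : fieldType) (f : {rmorphism A -> K}),
  (\rank (map_mx f e) < m)%N.
Hypothesis fact_neq0 : forall (K : fieldType) (f : {rmorphism A -> K}),
  (m`!)%:R != 0 :> K.

Variable T : {ffun 'I_m -> 'I_n} -> A.
Hypothesis T_alt : forall (a : {ffun 'I_m -> 'I_n}) (i j : 'I_m), i != j ->
  T [ffun k => a (tperm i j k)] = - T a.
Hypothesis T_proj : forall a : {ffun 'I_m -> 'I_n},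
  T a = \sum_(d : {ffun 'I_m -> 'I_n}) (\prod_i e (a i) (d i)) * T d.

Lemma alternating_perm (s : 'S_m) (a : {ffun 'I_m -> 'I_n}) :
  T [ffun k => a (s k)] = (-1) ^+ s * T a.
Proof.
have [ts -> _] := prod_tpermP s; elim: ts a => [|t ts IH] a.
  rewrite big_nil odd_perm1 expr0 mul1r; congr T.
  by apply/ffunP => k; rewrite ffunE perm1.
rewrite big_cons; set s' := (\prod_(_ <- _) _)%g.
have -> : [ffun k => a ((tperm t.1 t.2 * s')%g k)] =
          [ffun k => [ffun k => a (s' k)] (tperm t.1 t.2 k)].
  by apply/ffunP => k; rewrite !ffunE permM.
rewrite odd_mul_tperm signr_addb.
have [->|nt] := eqVneq t.1 t.2.
  rewrite tperm1 mul1r -IH; congr T.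
  by apply/ffunP => k; rewrite !ffunE perm1.
by rewrite T_alt // IH mulN1r mulNr.
Qed.

(* Averaging [T_proj] over the permutations of the arguments expresses m! T
   through the m x m minors of e, which vanish at every field. *)
Lemma alternating_vanish (a : {ffun 'I_m -> 'I_n}) : T a = 0.
Proof.
pose F := {ffun 'I_m -> 'I_n}.
have fact_T (b : F) :
    (m`!)%:R * T b = \sum_(d : F) \det (mxsub b d e) * T d.
  have <- : \sum_(s : 'S_m) T b = (m`!)%:R * T b.
    by rewrite sumr_const card_Sn mulr_natl.
  have step (s : 'S_m) : T b = \sum_(d : F)
      ((-1) ^+ s * \prod_i mxsub b d e i (s i)) * T d.
    (* Permuting the summation index by s moves s to the columns of e, at the price of the sign of
       s; the sum over s is then a determinant. *)
    rewrite T_proj (reindex_inj (h := fun d : F => [ffun k => d (s k)])) /=.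
      apply: eq_bigr => d _; rewrite alternating_perm mulrCA mulrA.
      by congr (_ * _ * _); apply: eq_bigr => i _; rewrite mxE ffunE.
    move=> d d' /ffunP dd'; apply/ffunP => k.
    by have := dd' ((s^-1)%g k); rewrite !ffunE permKV.
  rewrite (eq_bigr _ (fun s _ => step s)) exchange_big /=.
  by apply: eq_bigr => d _; rewrite -mulr_suml.
pose N := #|{: F}|; pose ev (i : 'I_N) : F := enum_val i.
(* The averaged identity reads [B *m t = 0]. At every field the minors drop out of [B] and leave the
   scalar m!. *)
pose B : 'M[A]_N := (m`!)%:R%:M - \matrix_(i, j) \det (mxsub (ev i) (ev j) e).
pose t : 'cV[A]_N := \col_i T (ev i).
suff /colP/(_ (enum_rank a)) : t = 0 by rewrite !mxE /ev enum_rankK.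
apply: (nakayama (B := B)) => [K f|].
  have -> : map_mx f B = (m`!)%:R%:M.
    apply/matrixP => i j; rewrite !mxE rmorphB rmorphMn rmorph_nat /=.
    rewrite -det_map_mx map_mxsub.
    suff -> : \det (mxsub (ev i) (ev j) (map_mx f e)) = 0.
      by rewrite subr0.
    apply/eqP; apply: contraTT (rk_e f) => det0; rewrite -leqNgt.
    have /mxrank_unit {1}<- : mxsub (ev i) (ev j) (map_mx f e) \in unitmx.
      by rewrite unitmxE unitfE.
    exact: rank_mxsub.
  by rewrite unitmxE det_scalar unitrX // unitfE; exact: fact_neq0.
apply/colP => i; rewrite mulmxBl mul_scalar_mx !mxE fact_T.
apply/eqP; rewrite subr_eq0; apply/eqP.
rewrite (reindex ev) /=; last first.
  by exists enum_rank => d _; rewrite /ev ?enum_valK ?enum_rankK.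
by apply: eq_bigr => j _; rewrite !mxE.
Qed.

End Alternating.

(** * Coordinates of spinors and the Clifford relations *)

(** Lists of bits make subsets of ['I_5] computable: an identity between spinors becomes 32 cases,
    in each of which signs and index sets reduce and [ring] concludes. *)
Definition bits_set (b : seq bool) : {set 'I_5} := finset (fun i : 'I_5 => nth false b i).

Lemma bits_setP (J : {set 'I_5}) :
  exists b0 b1 b2 b3 b4, J = bits_set [:: b0; b1; b2; b3; b4].
Proof.
pose m k := inord k \in J; exists (m 0), (m 1), (m 2), (m 3), (m 4).
apply/setP => i; rewrite inE -[in LHS](inord_val i).
by case: i => [] [|[|[|[|[|]]]]].
Qed.

Lemma bits_set_inj (b c : seq bool) : size b = 5 -> size c = 5 ->
  (bits_set b == bits_set c) = (b == c).
Proof.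
move=> sb sc; apply/eqP/eqP => [/setP bc|-> //].
apply: (@eq_from_nth _ false) => [|i]; first by rewrite sb sc.
by rewrite sb => i5; have := bc (Ordinal i5); rewrite !inE.
Qed.

Lemma card_bits_set (b : seq bool) : size b = 5 -> #|bits_set b| = count id b.
Proof.
move=> sb; rewrite -sum1_card big_mkcond /= !big_ord_recl big_ord0 !inE /=.
by case: b sb => [|? [|? [|? [|? [|? []]]]]] //= _; do 5 case: ifP.
Qed.

Section Coordinates.
Variable A : comNzRingType.
Implicit Types (v w : 'rV[A]_(5 + 5)) (s t : spinor A).

(** Indices are natural numbers so that numerals can be matched. As [inord] sends anything from 5 on
    to 0, statements about general indices carry bounds. *)
Definition coord_e v (i : nat) : A := v 0 (lshift 5 (inord i)).
Definition coord_f v (i : nat) : A := v 0 (rshift 5 (inord i)).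

Lemma spinor_bitsP s t :
  (forall b0 b1 b2 b3 b4, s (bits_set [:: b0; b1; b2; b3; b4]) =
     t (bits_set [:: b0; b1; b2; b3; b4])) -> s = t.
Proof.
by move=> st; apply/ffunP => J; have [b0 [b1 [b2 [b3 [b4 ->]]]]] := bits_setP J.
Qed.

Lemma sum5E (F : 'I_5 -> A) :
  \sum_(i < 5) F i = F (inord 0) + F (inord 1) + F (inord 2) + F (inord 3) + F (inord 4).
Proof.
rewrite !big_ord_recl big_ord0 addr0 !addrA.
by congr (F _ + F _ + F _ + F _ + F _); apply: val_inj; rewrite /= inordK.
Qed.

Lemma qpolarE v w : qpolar v w =
  (coord_e v 0 * coord_f w 0 + coord_e w 0 * coord_f v 0) +
  (coord_e v 1 * coord_f w 1 + coord_e w 1 * coord_f v 1) +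
  (coord_e v 2 * coord_f w 2 + coord_e w 2 * coord_f v 2) +
  (coord_e v 3 * coord_f w 3 + coord_e w 3 * coord_f v 3) +
  (coord_e v 4 * coord_f w 4 + coord_e w 4 * coord_f v 4).
Proof. by rewrite /qpolar sum5E !mxE. Qed.

Lemma qformE v : qform v =
  coord_e v 0 * coord_f v 0 + coord_e v 1 * coord_f v 1 +
  coord_e v 2 * coord_f v 2 + coord_e v 3 * coord_f v 3 +
  coord_e v 4 * coord_f v 4.
Proof. by rewrite /qform sum5E !mxE. Qed.

Definition clifford_term v s (b : seq bool) (i : nat) : A :=
  (-1) ^+ count id (take i b) *
  (if nth false b i then coord_e v i * s (bits_set (set_nth false b i false))
   else coord_f v i * s (bits_set (set_nth false b i true))).

Lemma cliffordE v s (b : seq bool) : size b = 5 ->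
  clifford v s (bits_set b) =
  clifford_term v s b 0 + clifford_term v s b 1 + clifford_term v s b 2 +
  clifford_term v s b 3 + clifford_term v s b 4.
Proof.
move=> sb; rewrite ffunE sum5E.
have term (i : nat) : (i < 5)%N ->
    (-1) ^+ #|[set j in bits_set b | (j < (inord i : 'I_5))%N]%SET| *
    (if inord i \in bits_set b
     then lsubmx v 0 (inord i) * s (bits_set b :\ inord i)%SET
     else rsubmx v 0 (inord i) * s (inord i |: bits_set b)%SET) =
    clifford_term v s b i.
  move=> i5; rewrite /clifford_term; congr (_ * _).
    congr (_ ^+ _); have : size (take i b ++ nseq (5 - i) false) = 5.
      by rewrite size_cat size_nseq size_take sb i5 subnKC // ltnW.
    move/card_bits_set; rewrite count_cat count_nseq /= addn0 => <-.
    apply: eq_card => j; rewrite !inE inordK // nth_cat size_take sb i5.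
    by case: ltnP => ji; rewrite ?andbT ?andbF ?nth_take // nth_nseq if_same.
  rewrite inE inordK //; case: ifP => bi; rewrite !mxE /coord_e /coord_f; congr (_ * s _).
    apply/setP => j; rewrite !inE nth_set_nth /= -val_eqE /= inordK //.
    by case: (_ == i).
  by apply/setP => j; rewrite !inE nth_set_nth /= -val_eqE /= inordK //.
by rewrite -!term.
Qed.

(** The only Clifford relation obtained by computing all coordinates; anticommutation follows from
    it by polarization. *)
Lemma clifford_square v s : clifford v (clifford v s) = qform v *: s.
Proof.
apply: spinor_bitsP => b0 b1 b2 b3 b4.
rewrite [RHS]ffunE qformE !cliffordE // /clifford_term /GRing.scale /=.
by case: b0; case: b1; case: b2; case: b3; case: b4 => /=;
  rewrite !cliffordE // /clifford_term /=; ring.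
Qed.

End Coordinates.

Section CliffordLinear.
Variable A : comNzRingType.
Implicit Types (v w : 'rV[A]_(5 + 5)) (s t : spinor A) (U : set 'rV[A]_(5 + 5)).

Lemma clifford_linearl a v w s :
  clifford (a *: v + w) s = a *: clifford v s + clifford w s.
Proof.
apply/ffunP => J; rewrite !ffunE [X in _ = X + _]mulr_sumr -big_split.
by apply: eq_bigr => i _ /=; rewrite !mxE; case: ifP => _; ring.
Qed.

Lemma clifford_linearr a v s t :
  clifford v (a *: s + t) = a *: clifford v s + clifford v t.
Proof.
apply/ffunP => J; rewrite !ffunE [X in _ = X + _]mulr_sumr -big_split.
apply: eq_bigr => i _ /=; rewrite !ffunE /GRing.scale /=.
by case: ifP => _; ring.
Qed.

Lemma clifford0l s : clifford 0 s = 0.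
Proof.
apply: (addrI (clifford 0 s)); rewrite addr0 -[X in X + _]scale1r.
by rewrite -clifford_linearl scaler0 addr0.
Qed.

Lemma clifford0r v : clifford v 0 = 0.
Proof.
apply: (addrI (clifford v 0)); rewrite addr0 -[X in X + _]scale1r.
by rewrite -clifford_linearr scaler0 addr0.
Qed.

Lemma cliffordZl a v s : clifford (a *: v) s = a *: clifford v s.
Proof. by rewrite -[a *: v]addr0 clifford_linearl clifford0l addr0. Qed.

Lemma cliffordZr a v s : clifford v (a *: s) = a *: clifford v s.
Proof. by rewrite -[a *: s]addr0 clifford_linearr clifford0r addr0. Qed.

Lemma cliffordNr v s : clifford v (- s) = - clifford v s.
Proof. by rewrite -scaleN1r cliffordZr scaleN1r. Qed.

Lemma cliffordNl v s : clifford (- v) s = - clifford v s.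
Proof. by rewrite -scaleN1r cliffordZl scaleN1r. Qed.

Lemma cliffordDl v w s : clifford (v + w) s = clifford v s + clifford w s.
Proof. by rewrite -[v]scale1r clifford_linearl !scale1r. Qed.

Lemma cliffordDr v s t : clifford v (s + t) = clifford v s + clifford v t.
Proof. by rewrite -[s]scale1r clifford_linearr !scale1r. Qed.

Lemma clifford_suml (I : finType) (v : I -> 'rV[A]_(5 + 5)) s :
  clifford (\sum_i v i) s = \sum_i clifford (v i) s.
Proof.
by elim/big_rec2: _ => [|i x y _ <-]; rewrite ?clifford0l ?cliffordDl.
Qed.

Lemma clifford_sumr (I : finType) v (s : I -> spinor A) :
  clifford v (\sum_i s i) = \sum_i clifford v (s i).
Proof.
by elim/big_rec2: _ => [|i x y _ <-]; rewrite ?clifford0r ?cliffordDr.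
Qed.

Lemma clifford_half_spin b v s :
  half_spin b s -> half_spin (~~ b) (clifford v s).
Proof.
move=> hs J oddJ; rewrite ffunE big1 // => i _.
case: ifP => iJ; rewrite hs ?mulr0 //.
  by rewrite (cardsD1 i J) iJ /= in oddJ; case: (b) oddJ; case: (odd _).
by rewrite cardsU1 iJ /=; case: (b) oddJ; case: (odd _).
Qed.

Lemma linspan0 (M : lmodType A) (S : set M) : linspan S 0.
Proof. by exists 0, (fun=> 0), (fun=> 0); split=> [[]|] //; rewrite big_ord0. Qed.

Lemma linspanD (M : lmodType A) (S : set M) x y :
  linspan S x -> linspan S y -> linspan S (x + y).
Proof.
move=> [m [c [w [Sw ->]]]] [n [d [z [Sz ->]]]].
exists (m + n)%N.
exists (fun i => match fintype.split i with inl j => c j | inr j => d j end).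
exists (fun i => match fintype.split i with inl j => w j | inr j => z j end).
split; first by move=> i; case: fintype.split.
rewrite big_split_ord /=; congr (_ + _); apply: eq_bigr => i _.
  by rewrite (unsplitK (inl i)).
by rewrite (unsplitK (inr i)).
Qed.

Lemma linspan_sum (M : lmodType A) (S : set M) (I : finType) (x : I -> M) :
  (forall i, linspan S (x i)) -> linspan S (\sum_i x i).
Proof.
by move=> Sx; elim/big_ind: _ => // [|y z]; [exact: linspan0 | exact: linspanD].
Qed.

Lemma clifford_image_mem b U u t :
  U u -> half_spin (~~ b) t -> clifford_image b U (clifford u t).
Proof. by move=> Uu ht; apply: linspan_sub; exists u => //; exists t. Qed.

Lemma rowspaceP (n : nat) (e : 'M[A]_n) (v : 'rV[A]_n) : e *m e = e ->
  rowspace e v <-> v *m e = v.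
Proof.
move=> ee; split; last by move=> <-; exists v.
by move=> [w _ <-]; rewrite -mulmxA ee.
Qed.

Lemma rowspace_row (n : nat) (e : 'M[A]_n) i : rowspace e (row i e).
Proof. by exists (delta_mx 0 i) => //; rewrite -rowE. Qed.

Lemma rowspace_linear (n : nat) (e : 'M[A]_n) a (v w : 'rV[A]_n) :
  rowspace e v -> rowspace e w -> rowspace e (a *: v + w).
Proof.
by move=> [v' _ <-] [w' _ <-]; exists (a *: v' + w') => //; rewrite mulmxDl scalemxAl.
Qed.

Lemma isotropic_polar U : isotropic_plane U ->
  forall u v, U u -> U v -> qpolar u v = 0.
Proof.
move=> [[e [ee Ue _]] oU] u v Uu Uv.
have : qform (u + v) = 0.
  apply: oU; rewrite Ue -[u]scale1r.
  by apply: rowspace_linear; rewrite -Ue.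
by rewrite qformD !oU // !add0r.
Qed.

Lemma clifford_anticomm v w s :
  clifford v (clifford w s) + clifford w (clifford v s) = qpolar v w *: s.
Proof.
have := clifford_square (v + w) s.
rewrite qformD !scalerDl !cliffordDl !cliffordDr !clifford_square.
by rewrite [_ + qform w *: s]addrC addrACA => /addrI.
Qed.

Lemma clifford_polar0 v w s : qpolar v w = 0 ->
  clifford v (clifford w s) = - clifford w (clifford v s).
Proof.
move=> vw; apply/eqP; rewrite -addr_eq0 clifford_anticomm vw.
by rewrite scale0r.
Qed.

End CliffordLinear.

Lemma sum_ffun2 (V : nmodType) (I : finType) (F : {ffun 'I_2 -> I} -> V) :
  \sum_d F d = \sum_i \sum_j F [ffun k : 'I_2 => if k == 0 then i else j].
Proof.
rewrite pair_bigA /=.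
rewrite (reindex (fun p : I * I => [ffun k : 'I_2 => if k == 0 then p.1 else p.2])) //=.
exists (fun d : {ffun 'I_2 -> I} => (d 0, d 1)) => [[i j] _ | d _] /=; first by rewrite !ffunE.
apply/ffunP => k; rewrite ffunE.
by case: (unliftP 0 k) => [j|] -> //=; rewrite ord1; congr (d _); apply: val_inj.
Qed.

Lemma sum_ffun3 (V : nmodType) (I : finType) (F : {ffun 'I_3 -> I} -> V) :
  \sum_d F d = \sum_i \sum_j \sum_l
    F [ffun k : 'I_3 => if k == 0 then i else if k == 1 then j else l].
Proof.
rewrite pair_bigA /= pair_bigA /=.
rewrite (reindex (fun p : I * I * I => [ffun k : 'I_3 =>
   if k == 0 then p.1.1 else if k == 1 then p.1.2 else p.2])) //=.
exists (fun d : {ffun 'I_3 -> I} => (d 0, d 1, d (inord 2))) => [[[i j] l] _ | d _] /=.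
  by rewrite !ffunE /= -!val_eqE /= inordK.
apply/ffunP => k; rewrite ffunE -!val_eqE /=.
by case: k => [] [|[|[|//]]] lk /=; congr (d _); apply: val_inj; rewrite /= ?inordK.
Qed.

Section RankOne.
Variables (A : comNzRingType) (n : nat) (e : 'M[A]_n).
Hypotheses (ee : e *m e = e)
  (rk_e : forall (K : fieldType) (f : {rmorphism A -> K}), \rank (map_mx f e) = 1%N)
  (char_neq2 : forall (K : fieldType) (f : {rmorphism A -> K}), 2%:R != 0 :> K).

Let e_sum i k : \sum_d e i d * e d k = e i k.
Proof. by rewrite -[in RHS]ee !mxE. Qed.

(** Rank one at fields makes these minors vanish only at fields. They vanish in A because the minor
    in two fixed columns is an alternating function of its two rows, reproduced by e since e is
    idempotent. *)
Lemma rank_one_minors i j k l : e i k * e j l = e i l * e j k.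
Proof.
pose T (a : {ffun 'I_2 -> 'I_n}) := e (a 0) k * e (a 1) l - e (a 0) l * e (a 1) k.
pose a := [ffun x : 'I_2 => if x == 0 then i else j].
have : T a = 0; last first.
  by rewrite /T !ffunE /= => /eqP; rewrite subr_eq0 => /eqP.
apply: (alternating_vanish (e := e)) => // [K f|b x y xy|b].
- by rewrite rk_e.
- have I2 (z : 'I_2) : z = 0 \/ z = 1.
    by case: z => [[|[|//]] lz]; [left | right]; apply: val_inj.
  have [E0 E1] : tperm x y 0 = 1 /\ tperm x y 1 = 0 :> 'I_2.
    by case: (I2 x) xy => ->; case: (I2 y) => ->; rewrite ?eqxx ?tpermL ?tpermR.
  by rewrite /T !ffunE E0 E1; ring.
- rewrite sum_ffun2 /T.
  under eq_bigr => x _ do under eq_bigr => y _ do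
    rewrite big_ord_recl big_ord1 !ffunE /= mulrBr.
  under eq_bigr do rewrite sumrB.
  rewrite sumrB -!(e_sum (b 0)) -!(e_sum (b 1)) !big_distrlr /=.
  by congr (_ - _); apply: eq_bigr => x _; apply: eq_bigr => y _;
    rewrite (_ : lift 0 0 = 1); [ring | apply: val_inj | ring | apply: val_inj].
Qed.

(** The minors give \tr e * e = e * e = e, so the trace is idempotent. Where it vanished, e would
    vanish as well, against rank one; so it is also a unit, hence 1. *)
Lemma rank_one_trace : \tr e = 1.
Proof.
have tre k l : \tr e * e k l = e k l.
  rewrite /mxtrace mulr_suml -[in RHS]e_sum.
  by apply: eq_bigr => i _; rewrite [LHS]rank_one_minors mulrC.
have [|b bt] := @invertible_at_fields A (\tr e).
  move=> K f; apply/eqP => ft0.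
  have := rk_e f; suff -> : map_mx f e = 0 by rewrite mxrank0.
  by apply/matrixP => k l; rewrite !mxE -tre rmorphM ft0 mul0r.
have tt : \tr e * \tr e = \tr e.
  by rewrite {2 3}/mxtrace mulr_sumr; apply: eq_bigr => i _; exact: tre.
by rewrite -[LHS]mul1r -bt -mulrA tt.
Qed.

End RankOne.

(** Since s is a combination of spinors w t with w in U, the spinor u v s involves three vectors of
    U. Such products anticommute, so each coordinate is alternating in three rows of a projector of
    rank two, and [alternating_vanish] applies with m = 3, whence the condition on 6 = 3!. *)
Lemma isotropic_plane_kill (A : comNzRingType)
    (char_neq6 : forall (K : fieldType) (f : {rmorphism A -> K}), 6%:R != 0 :> K)
    (U : set 'rV[A]_(5 + 5)) (b : bool) (s : spinor A) :
  isotropic_plane U -> clifford_image b U s ->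
  forall u v, U u -> U v -> clifford u (clifford v s) = 0.
Proof.
move=> iU; have [[e [ee Ue rk_e]] _] := iU; have pU := isotropic_polar iU.
have alt u v t : U u -> U v -> clifford u (clifford v t) = - clifford v (clifford u t).
  by move=> Uu Uv; apply: clifford_polar0; exact: pU.
have rU i : U (row i e) by rewrite Ue; exact: rowspace_row.
have rowK i : row i e = \sum_d e i d *: row d e.
  rewrite -[in LHS]ee row_mul mulmx_sum_row.
  by apply: eq_bigr => d _; rewrite mxE.
have UK u : U u -> u = \sum_d u 0 d *: row d e.
  by rewrite Ue => /(rowspaceP _ ee) {1}<-; rewrite mulmx_sum_row.
have vanish i j l t :
    clifford (row i e) (clifford (row j e) (clifford (row l e) t)) = 0.
  apply/ffunP => J; rewrite [RHS]ffunE.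
  pose T (a : {ffun 'I_3 -> 'I_(5 + 5)}) := clifford (row (a 0) e)
     (clifford (row (a 1) e) (clifford (row (a (inord 2)) e) t)) J.
  pose a := [ffun k : 'I_3 => if k == 0 then i else if k == 1 then j else l].
  suff : T a = 0 by rewrite /T !ffunE /= -!val_eqE /= inordK.
  apply: (alternating_vanish (e := e)) => // [K f|c x y xy|c].
  - by rewrite rk_e.
  - have I3 (z : 'I_3) : [\/ z = 0, z = 1 | z = inord 2].
      case: z => [[|[|[|//]]] lz]; [constructor 1 | constructor 2 | constructor 3];
        by apply: val_inj; rewrite /= ?inordK.
    have n02 : (0 == inord 2 :> 'I_3) = false by rewrite -val_eqE /= inordK.
    have n12 : (1 == inord 2 :> 'I_3) = false by rewrite -val_eqE /= inordK.
    have e01 t' := alt _ _ t' (rU (c 0)) (rU (c 1)).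
    have e12 t' := alt _ _ t' (rU (c 1)) (rU (c (inord 2))).
    have e02 t' := alt _ _ t' (rU (c 0)) (rU (c (inord 2))).
    have tE z : [ffun k => c (tperm x y k)] z = c (tperm x y z) by rewrite ffunE.
    rewrite /T !tE.
    have negE (s' s'' : spinor A) : s' = - s'' -> s' J = - s'' J.
      by move=> ->; rewrite [LHS]ffunE.
    case: (I3 x) xy => ->; case: (I3 y) => ->; rewrite ?eqxx // => _;
      rewrite /tperm !permE /= ?eqxx ?n02 ?n12 ?[inord 2 == _]eq_sym ?n02 ?n12 /=;
      apply: negE; rewrite [in RHS]e01 opprK //.
    - by rewrite e02 cliffordNr e12 opprK.
    - by rewrite -[clifford (row (c (inord 2)) e) _]opprK -e12 cliffordNr e01 opprK.
    - by rewrite e02 cliffordNr e12 opprK.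
    - by rewrite -[clifford (row (c (inord 2)) e) _]opprK -e12 cliffordNr e01 opprK.
  - rewrite sum_ffun3 /T (rowK (c 0)) (rowK (c 1)) (rowK (c (inord 2))).
    rewrite clifford_suml sum_ffunE; apply: eq_bigr => d0 _.
    rewrite clifford_suml clifford_sumr sum_ffunE; apply: eq_bigr => d1 _.
    rewrite clifford_suml !clifford_sumr sum_ffunE; apply: eq_bigr => d2 _.
    set D := [ffun k => _].
    have [-> -> ->] : [/\ D 0 = d0, D 1 = d1 & D (inord 2) = d2].
      by rewrite /D !ffunE /= -!val_eqE /= inordK.
    have -> : \prod_k e (c k) (D k) = e (c 0) d0 * e (c 1) d1 * e (c (inord 2)) d2.
      rewrite !big_ord_recl big_ord0 mulr1 mulrA.
      have -> : lift ord0 (lift ord0 ord0) = inord 2 :> 'I_3.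
        by apply: val_inj; rewrite /= inordK.
      have -> : lift ord0 ord0 = 1 :> 'I_3 by exact: val_inj.
      by rewrite /D !ffunE /= -!val_eqE /= inordK.
    by rewrite !cliffordZl !cliffordZr !scalerA [LHS]ffunE.
have vanishU u v w t : U u -> U v -> U w -> clifford u (clifford v (clifford w t)) = 0.
  move=> /UK-> /UK-> /UK->.
  rewrite clifford_suml big1 // => i _; rewrite clifford_suml clifford_sumr big1 // => j _.
  rewrite clifford_suml !clifford_sumr big1 // => l _.
  by rewrite !cliffordZl !cliffordZr vanish !scaler0.
move=> [m [c [x [Sx ->]]]] u v Uu Uv.
rewrite !clifford_sumr big1 // => i _; rewrite !cliffordZr.
by have [w Uw [t _ <-]] := Sx i; rewrite vanishU // scaler0.
Qed.

(** * The zero locus of a normal form *)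

Section NormalForm.
Variable A : comNzRingType.
Implicit Types (u v : 'rV[A]_(5 + 5)) (p r : A).

Definition even_nf p r : spinor A :=
  [ffun J => if J == bits_set [:: false; false; false; false; false] then p
   else if J == bits_set [:: true; true; true; true; false] then r else 0].

Definition odd_nf p r : spinor A :=
  [ffun J => if J == bits_set [:: false; false; false; false; true] then p
   else if J == bits_set [:: true; true; true; true; true] then r else 0].

Lemma even_nfE p r (b : seq bool) : size b = 5 -> even_nf p r (bits_set b) =
  if b == [:: false; false; false; false; false] then p
  else if b == [:: true; true; true; true; false] then r else 0.
Proof. by move=> sb; rewrite ffunE !bits_set_inj. Qed.

Lemma odd_nfE p r (b : seq bool) : size b = 5 -> odd_nf p r (bits_set b) =
  if b == [:: false; false; false; false; true] then p
  else if b == [:: true; true; true; true; true] then r else 0.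
Proof. by move=> sb; rewrite ffunE !bits_set_inj. Qed.

Lemma even_nf_half_spin p r : half_spin false (even_nf p r).
Proof.
move=> J oJ; rewrite ffunE; do 2 (case: eqP => [JE|_]; first by
  move: oJ; rewrite JE card_bits_set).
by [].
Qed.

Lemma odd_nf_half_spin p r : half_spin true (odd_nf p r).
Proof.
move=> J oJ; rewrite ffunE; do 2 (case: eqP => [JE|_]; first by
  move: oJ; rewrite JE card_bits_set).
by [].
Qed.

Definition minor_ee u v i j := coord_e u i * coord_e v j - coord_e v i * coord_e u j.
Definition minor_ff u v i j := coord_f u i * coord_f v j - coord_f v i * coord_f u j.
Definition minor_ef u v i j := coord_e u i * coord_f v j - coord_e v i * coord_f u j.
Definition low_pairing u v :=
  coord_f u 0 * coord_e v 0 + coord_f u 1 * coord_e v 1 +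
  coord_f u 2 * coord_e v 2 + coord_f u 3 * coord_e v 3.

(** Minors inside E4 meet the complementary minors inside F4, with coefficients p and r; minors
    involving the index 4 stand alone. Mixed minors with both indices below 4 are absent, and E4
    meets F4 only through [low_pairing]: this is the freedom left to the flag. *)
Lemma clifford2_even_nf u v p r (b0 b1 b2 b3 b4 : bool) :
  clifford u (clifford v (even_nf p r)) (bits_set [:: b0; b1; b2; b3; b4]) =
  match b0, b1, b2, b3, b4 with
  | false, false, false, false, false => p * (low_pairing u v + coord_f u 4 * coord_e v 4)
  | true, true, true, true, false => r * (low_pairing v u + coord_f u 4 * coord_e v 4)
  | true, true, false, false, false => p * minor_ee u v 0 1 - r * minor_ff u v 2 3
  | true, false, true, false, false => p * minor_ee u v 0 2 + r * minor_ff u v 1 3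
  | true, false, false, true, false => p * minor_ee u v 0 3 - r * minor_ff u v 1 2
  | false, true, true, false, false => p * minor_ee u v 1 2 - r * minor_ff u v 0 3
  | false, true, false, true, false => p * minor_ee u v 1 3 + r * minor_ff u v 0 2
  | false, false, true, true, false => p * minor_ee u v 2 3 - r * minor_ff u v 0 1
  | true, false, false, false, true => p * minor_ee u v 0 4
  | false, true, false, false, true => p * minor_ee u v 1 4
  | false, false, true, false, true => p * minor_ee u v 2 4
  | false, false, false, true, true => p * minor_ee u v 3 4
  | true, true, true, false, true => r * minor_ef u v 4 3
  | true, true, false, true, true => - (r * minor_ef u v 4 2)
  | true, false, true, true, true => r * minor_ef u v 4 1
  | false, true, true, true, true => - (r * minor_ef u v 4 0)
  | _, _, _, _, _ => 0
  end.
Proof.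
rewrite !cliffordE // /clifford_term /=.
case: b0; case: b1; case: b2; case: b3; case: b4 => /=;
  rewrite !cliffordE // /clifford_term /= !even_nfE //=;
  rewrite /minor_ee /minor_ff /minor_ef /low_pairing; ring.
Qed.

Lemma clifford2_odd_nf u v p r (b0 b1 b2 b3 b4 : bool) :
  clifford u (clifford v (odd_nf p r)) (bits_set [:: b0; b1; b2; b3; b4]) =
  match b0, b1, b2, b3, b4 with
  | false, false, false, false, true => p * (low_pairing u v + coord_e u 4 * coord_f v 4)
  | true, true, true, true, true => r * (low_pairing v u + coord_e u 4 * coord_f v 4)
  | true, true, false, false, true => p * minor_ee u v 0 1 - r * minor_ff u v 2 3
  | true, false, true, false, true => p * minor_ee u v 0 2 + r * minor_ff u v 1 3
  | true, false, false, true, true => p * minor_ee u v 0 3 - r * minor_ff u v 1 2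
  | false, true, true, false, true => p * minor_ee u v 1 2 - r * minor_ff u v 0 3
  | false, true, false, true, true => p * minor_ee u v 1 3 + r * minor_ff u v 0 2
  | false, false, true, true, true => p * minor_ee u v 2 3 - r * minor_ff u v 0 1
  | true, false, false, false, false => p * minor_ef u v 0 4
  | false, true, false, false, false => p * minor_ef u v 1 4
  | false, false, true, false, false => p * minor_ef u v 2 4
  | false, false, false, true, false => p * minor_ef u v 3 4
  | true, true, true, false, false => - (r * minor_ff u v 3 4)
  | true, true, false, true, false => r * minor_ff u v 2 4
  | true, false, true, true, false => - (r * minor_ff u v 1 4)
  | false, true, true, true, false => r * minor_ff u v 0 4
  | _, _, _, _, _ => 0
  end.
Proof.
rewrite !cliffordE // /clifford_term /=.
case: b0; case: b1; case: b2; case: b3; case: b4 => /=;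
  rewrite !cliffordE // /clifford_term /= !odd_nfE //=;
  rewrite /minor_ee /minor_ff /minor_ef /low_pairing; ring.
Qed.

(** A minor inside E4 and its complement inside F4 satisfy two linear equations, one from each
    half-spinor, of determinant p1 r2 - p2 r1 up to sign. Over A, [GRing.lreg] is what allows
    coefficients to be cancelled. *)
Lemma nf_minors u v (p1 r1 p2 r2 : A) :
  GRing.lreg p1 -> GRing.lreg r1 -> GRing.lreg p2 -> GRing.lreg r2 ->
  GRing.lreg (p1 * r2 - p2 * r1) ->
  clifford u (clifford v (even_nf p1 r1)) = 0 ->
  clifford u (clifford v (odd_nf p2 r2)) = 0 ->
  [/\ forall i j, (i < 5)%N -> (j < 5)%N -> coord_e u i * coord_e v j = coord_e v i * coord_e u j,
      forall i j, (i < 5)%N -> (j < 5)%N -> coord_f u i * coord_f v j = coord_f v i * coord_f u j,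
      forall j, (j < 5)%N -> coord_e u 4 * coord_f v j = coord_e v 4 * coord_f u j,
      forall i, (i < 5)%N -> coord_e u i * coord_f v 4 = coord_e v i * coord_f u 4 &
      low_pairing u v + coord_f u 4 * coord_e v 4 = 0].
Proof.
move=> Lp1 Lr1 Lp2 Lr2 Ld H1 H2.
have L0 (x y : A) : GRing.lreg x -> x * y = 0 -> y = 0.
  by move=> Lx xy; apply: Lx; rewrite xy mulr0.
have E b0 b1 b2 b3 b4 := etrans (esym (clifford2_even_nf u v p1 r1 b0 b1 b2 b3 b4))
  (etrans (congr1 (fun s : spinor A => s _) H1) (ffunE _ _)).
have O b0 b1 b2 b3 b4 := etrans (esym (clifford2_odd_nf u v p2 r2 b0 b1 b2 b3 b4))
  (etrans (congr1 (fun s : spinor A => s _) H2) (ffunE _ _)).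
have key (m m' : A) : p1 * m - r1 * m' = 0 -> p2 * m - r2 * m' = 0 -> m = 0 /\ m' = 0.
  move=> h1 h2; suff m0 : m = 0.
    by split=> //; apply: (L0 _ _ Lr1); move/eqP: h1; rewrite m0 mulr0 sub0r oppr_eq0 => /eqP.
  apply: (L0 _ _ Ld).
  have -> : (p1 * r2 - p2 * r1) * m = r2 * (p1 * m - r1 * m') - r1 * (p2 * m - r2 * m') by ring.
  by rewrite h1 h2 !mulr0 subr0.
have keyN (m m' : A) : p1 * m + r1 * m' = 0 -> p2 * m + r2 * m' = 0 -> m = 0 /\ m' = 0.
  move=> h1 h2; have [||-> /eqP] := key m (- m'); rewrite ?mulrN ?opprK //.
  by rewrite oppr_eq0 => /eqP.
have N0 (x y : A) : GRing.lreg x -> - (x * y) = 0 -> y = 0.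
  by move=> Lx /eqP; rewrite oppr_eq0 => /eqP; exact: L0.
have [e01 f23] := key _ _ (E true true false false false) (O true true false false true).
have [e02 f13] := keyN _ _ (E true false true false false) (O true false true false true).
have [e03 f12] := key _ _ (E true false false true false) (O true false false true true).
have [e12 f03] := key _ _ (E false true true false false) (O false true true false true).
have [e13 f02] := keyN _ _ (E false true false true false) (O false true false true true).
have [e23 f01] := key _ _ (E false false true true false) (O false false true true true).
have e04 := L0 _ _ Lp1 (E true false false false true).
have e14 := L0 _ _ Lp1 (E false true false false true).
have e24 := L0 _ _ Lp1 (E false false true false true).
have e34 := L0 _ _ Lp1 (E false false false true true).
have f34 := N0 _ _ Lr2 (O true true true false false).
have f24 := L0 _ _ Lr2 (O true true false true false).
have f14 := N0 _ _ Lr2 (O true false true true false).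
have f04 := L0 _ _ Lr2 (O false true true true false).
have ef43 := L0 _ _ Lr1 (E true true true false true).
have ef42 := N0 _ _ Lr1 (E true true false true true).
have ef41 := L0 _ _ Lr1 (E true false true true true).
have ef40 := N0 _ _ Lr1 (E false true true true true).
have ef04 := L0 _ _ Lp2 (O true false false false false).
have ef14 := L0 _ _ Lp2 (O false true false false false).
have ef24 := L0 _ _ Lp2 (O false false true false false).
have ef34 := L0 _ _ Lp2 (O false false false true false).
have fe1 := L0 _ _ Lp1 (E false false false false false).
have fe2 := L0 _ _ Lp2 (O false false false false true).
(* The lowest coordinates of the two halves contain the same [low_pairing u v]; their difference is
   this minor. *)
have ef44 : minor_ef u v 4 4 = 0.
  by rewrite -[RHS](subrr 0) -{1}fe2 -fe1 /minor_ef; ring.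
have sw (x y : A) : x - y = 0 -> x = y by move/eqP; rewrite subr_eq0 => /eqP.
have ws (a b c d : A) : a * b - c * d = 0 -> d * c = b * a.
  by move/sw => h; rewrite mulrC -h mulrC.
split; last exact: fe1.
- by move=> [|[|[|[|[|i]]]]] [|[|[|[|[|j]]]]] // _ _; first [exact: sw | exact: mulrC | exact: ws].
- by move=> [|[|[|[|[|i]]]]] [|[|[|[|[|j]]]]] // _ _; first [exact: sw | exact: mulrC | exact: ws].
- by move=> [|[|[|[|[|j]]]]] // _; exact: sw.
- by move=> [|[|[|[|[|j]]]]] // _; exact: sw.
Qed.

End NormalForm.

(** * The plane L + M attached to a flag in E4 *)

Section Plane.
Variable A : comNzRingType.
Implicit Types (L H : set 'rV[A]_4) (a b l h : 'rV[A]_4) (u v : 'rV[A]_(5 + 5)).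

Definition low_col_E (i : 'I_4) : 'I_(5 + 5) := lshift 5 (widen_ord (leqnSn 4) i).
Definition low_col_F (i : 'I_4) : 'I_(5 + 5) := rshift 5 (widen_ord (leqnSn 4) i).
Definition inE4 : 'M[A]_(4, 5 + 5) := rowsub low_col_E 1%:M.
Definition inF4 : 'M[A]_(4, 5 + 5) := rowsub low_col_F 1%:M.

Lemma col_cases (c : 'I_(5 + 5)) :
  [\/ exists k, c = low_col_E k, exists k, c = low_col_F k,
      c = lshift 5 ord_max | c = rshift 5 ord_max].
Proof.
case: (split_ordP c) => j ->; have [j4|] := ltnP j 4.
- by constructor 1; exists (Ordinal j4); congr lshift; apply: val_inj.
- move=> j4; constructor 3; congr lshift; apply: val_inj => /=.
  by apply/eqP; rewrite eqn_leq j4 -ltnS ltn_ord.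
- by constructor 2; exists (Ordinal j4); congr rshift; apply: val_inj.
- move=> j4; constructor 4; congr rshift; apply: val_inj => /=.
  by apply/eqP; rewrite eqn_leq j4 -ltnS ltn_ord.
Qed.

Lemma mul_inE4T m (M : 'M[A]_(m, 5 + 5)) : M *m inE4^T = colsub low_col_E M.
Proof. by rewrite trmx_mxsub trmx1 mulmx_colsub mulmx1. Qed.

Lemma mul_inF4T m (M : 'M[A]_(m, 5 + 5)) : M *m inF4^T = colsub low_col_F M.
Proof. by rewrite trmx_mxsub trmx1 mulmx_colsub mulmx1. Qed.

Lemma inE4K : inE4 *m inE4^T = 1%:M.
Proof. by rewrite mul_inE4T; apply/matrixP => i j; rewrite !mxE (inj_eq (@lshift_inj _ _)). Qed.

Lemma inF4K : inF4 *m inF4^T = 1%:M.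
Proof. by rewrite mul_inF4T; apply/matrixP => i j; rewrite !mxE (inj_eq (@rshift_inj _ _)). Qed.

Lemma inE4F : inE4 *m inF4^T = 0.
Proof. by rewrite mul_inF4T; apply/matrixP => i j; rewrite !mxE eq_lrshift. Qed.

Lemma inF4E : inF4 *m inE4^T = 0.
Proof. by rewrite mul_inE4T; apply/matrixP => i j; rewrite !mxE eq_rlshift. Qed.

Lemma inE4E_out (c : 'I_(5 + 5)) : (forall k, c != low_col_E k) ->
  forall a, (a *m inE4) 0 c = 0.
Proof.
move=> nc a; rewrite mxE big1 // => k _.
by rewrite !mxE eq_sym (negbTE (nc k)) mulr0.
Qed.

Lemma inF4E_out (c : 'I_(5 + 5)) : (forall k, c != low_col_F k) ->
  forall a, (a *m inF4) 0 c = 0.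
Proof.
move=> nc a; rewrite mxE big1 // => k _.
by rewrite !mxE eq_sym (negbTE (nc k)) mulr0.
Qed.

Lemma coord_e_inE4 a i : (i < 5)%N ->
  coord_e (a *m inE4) i = if (i < 4)%N then a 0 (inord i) else 0.
Proof.
move=> i5; case: ifP => i4.
  have {2}-> : a = a *m inE4 *m inE4^T by rewrite -mulmxA inE4K mulmx1.
  rewrite mul_inE4T mxE; congr (_ _ (lshift _ _)); apply: val_inj.
  by rewrite /= !inordK.
apply: inE4E_out => k; rewrite (inj_eq (@lshift_inj _ _)) -val_eqE /= inordK //.
by apply: contraFneq i4 => ->.
Qed.

Lemma coord_f_inE4 a i : coord_f (a *m inE4) i = 0.
Proof. by apply: inE4E_out => k; rewrite eq_rlshift. Qed.

Lemma coord_f_inF4 a i : (i < 5)%N ->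
  coord_f (a *m inF4) i = if (i < 4)%N then a 0 (inord i) else 0.
Proof.
move=> i5; case: ifP => i4.
  have {2}-> : a = a *m inF4 *m inF4^T by rewrite -mulmxA inF4K mulmx1.
  rewrite mul_inF4T mxE; congr (_ _ (rshift _ _)); apply: val_inj.
  by rewrite /= !inordK.
apply: inF4E_out => k; rewrite (inj_eq (@rshift_inj _ _)) -val_eqE /= inordK //.
by apply: contraFneq i4 => ->.
Qed.

Lemma coord_e_inF4 a i : coord_e (a *m inF4) i = 0.
Proof. by apply: inF4E_out => k; rewrite eq_lrshift. Qed.

Lemma coord_eD u v i : coord_e (u + v) i = coord_e u i + coord_e v i. Proof. exact: mxE. Qed.
Lemma coord_fD u v i : coord_f (u + v) i = coord_f u i + coord_f v i. Proof. exact: mxE. Qed.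

Lemma dot4E a b : (a *m b^T) 0 0 = a 0 (inord 0) * b 0 (inord 0) +
  a 0 (inord 1) * b 0 (inord 1) + a 0 (inord 2) * b 0 (inord 2) +
  a 0 (inord 3) * b 0 (inord 3).
Proof.
rewrite mxE !big_ord_recl big_ord0 addr0 !addrA !mxE.
by congr (a 0 _ * b 0 _ + a 0 _ * b 0 _ + a 0 _ * b 0 _ + a 0 _ * b 0 _);
  apply: val_inj; rewrite /= inordK.
Qed.

Lemma qform_low a b : qform (a *m inE4 + b *m inF4) = (a *m b^T) 0 0.
Proof.
rewrite qformE dot4E !coord_eD !coord_fD.
by rewrite !coord_e_inE4 // !coord_f_inE4 !coord_f_inF4 // !coord_e_inF4 /=; ring.
Qed.

Lemma qpolar_inE4F a b : qpolar (a *m inE4) (b *m inF4) = (a *m b^T) 0 0.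
Proof.
by rewrite qpolarE !dot4E !coord_e_inE4 // !coord_f_inE4 !coord_f_inF4 // !coord_e_inF4 /=; ring.
Qed.

Lemma qpolar_inE4E a b : qpolar (a *m inE4) (b *m inE4) = 0.
Proof. by rewrite qpolarE !coord_e_inE4 // !coord_f_inE4; ring. Qed.

Lemma low_decomp u : coord_e u 4 = 0 -> coord_f u 4 = 0 ->
  u = u *m inE4^T *m inE4 + u *m inF4^T *m inF4.
Proof.
have i4 : inord 4 = ord_max :> 'I_5 by apply: val_inj; rewrite /= inordK.
rewrite /coord_e /coord_f i4 => e4 f4; set w := RHS.
have wE : w *m inE4^T = u *m inE4^T.
  by rewrite mulmxDl -!mulmxA inE4K inF4E !mulmx0 mulmx1 addr0.
have wF : w *m inF4^T = u *m inF4^T.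
  by rewrite mulmxDl -!mulmxA inE4F inF4K !mulmx0 mulmx1 add0r.
apply/rowP => c; case: (col_cases c) => [[k ->]|[k ->]|->|->].
- by move/rowP/(_ k): wE; rewrite !mul_inE4T !mxE.
- by move/rowP/(_ k): wF; rewrite !mul_inF4T !mxE.
- rewrite e4 mxE inE4E_out ?inF4E_out ?addr0 // => k; rewrite ?eq_lrshift //.
  by rewrite (inj_eq (@lshift_inj _ _)) -val_eqE /= gtn_eqF // ltn_ord.
- rewrite f4 mxE inE4E_out ?inF4E_out ?addr0 // => k; rewrite ?eq_rlshift //.
  by rewrite (inj_eq (@rshift_inj _ _)) -val_eqE /= gtn_eqF // ltn_ord.
Qed.

(** F4 is read as the dual of E4, and h runs over the annihilator of H, which is the line M. *)
Definition plane L H : set 'rV[A]_(5 + 5) :=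
  [set u : 'rV[A]_(5 + 5) | exists l h : 'rV[A]_4, [/\ L l, forall x, H x -> h *m x^T = 0 &
                          u = l *m inE4 + h *m inF4]].

Definition plane_mx (e g : 'M[A]_4) : 'M[A]_(5 + 5) :=
  inE4^T *m e *m inE4 + inF4^T *m g *m inF4.

Lemma low_mul_plane_mx m (e g : 'M[A]_4) (l h : 'M[A]_(m, 4)) :
  (l *m inE4 + h *m inF4) *m plane_mx e g = l *m e *m inE4 + h *m g *m inF4.
Proof.
rewrite /plane_mx mulmxDl !mulmxDr !mulmxA -(mulmxA l) -(mulmxA h).
rewrite -(mulmxA l inE4) -(mulmxA h inF4) inE4K inF4K inE4F inF4E.
by rewrite !mulmx1 !mulmx0 !mul0mx addr0 add0r.
Qed.

Lemma plane_mx_idem (e g : 'M[A]_4) : e *m e = e -> g *m g = g ->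
  plane_mx e g *m plane_mx e g = plane_mx e g.
Proof.
move=> ee gg; rewrite {1}/plane_mx low_mul_plane_mx.
by rewrite -!(mulmxA _ e e) -!(mulmxA _ g g) ee gg.
Qed.

(** A row h kills the image of g exactly when h g^T = 0, that is, when the transpose of 1 - g fixes
    h. So this transpose is a projector onto the annihilator. *)
Lemma plane_rowspace (e g : 'M[A]_4) : e *m e = e -> g *m g = g ->
  plane (rowspace e) (rowspace g) = rowspace (plane_mx e (1%:M - g)^T).
Proof.
move=> ee gg; have g'g : (1%:M - g) *m g = 0 by rewrite mulmxBl mul1mx gg subrr.
have gg' : g *m (1%:M - g) = 0 by rewrite mulmxBr mulmx1 gg subrr.
apply/seteqP; split=> [_ [l [h [Ll Hh ->]]]|_ [w _ <-]].
  exists (l *m inE4 + h *m inF4) => //; rewrite low_mul_plane_mx.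
  have hg : h *m g^T = 0.
    apply/rowP => i; have := Hh _ (rowspace_row g i).
    move/rowP/(_ 0); rewrite !mxE => hgi; rewrite -[RHS]hgi.
    by apply: eq_bigr => j _; rewrite !mxE.
  rewrite linearB /= trmx1 mulmxBr mulmx1 hg subr0.
  by congr (_ *m _ + _); apply/rowspaceP.
exists (w *m inE4^T *m e), (w *m inF4^T *m (1%:M - g)^T); split.
- by exists (w *m inE4^T).
- by move=> _ [v _ <-]; rewrite trmx_mul -!mulmxA (mulmxA _ g^T) -trmx_mul gg' trmx0 mul0mx !mulmx0.
- by rewrite /plane_mx mulmxDr !mulmxA.
Qed.

End Plane.

Lemma map_plane_mx (A B : comNzRingType) (f : {rmorphism A -> B}) (e g : 'M[A]_4) :
  map_mx f (plane_mx e g) = plane_mx (map_mx f e) (map_mx f g).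
Proof. by rewrite /plane_mx map_mxD !map_mxM -!map_trmx !map_mxsub !map_mx1. Qed.

Lemma rank_plane_mx (K : fieldType) (e g : 'M[K]_4) :
  \rank (plane_mx e g) = (\rank e + \rank g)%N.
Proof.
pose B : 'M[K]_(4 + 4, 5 + 5) := col_mx (inE4 K) (inF4 K).
have BK : B *m B^T = 1%:M.
  by rewrite tr_col_mx mul_col_row inE4K inF4K inE4F inF4E -scalar_mx_block.
have PE : plane_mx e g = B^T *m block_mx e 0 0 g *m B.
  by rewrite tr_col_mx mul_row_block !mulmx0 addr0 add0r mul_row_col.
rewrite -rank_diag_block_mx; apply/eqP; rewrite eqn_leq PE; apply/andP; split.
  by apply: leq_trans (mxrankM_maxl _ _) (mxrankM_maxr _ _).
have {1}-> : block_mx e 0 0 g = B *m (B^T *m block_mx e 0 0 g *m B) *m B^T.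
  by rewrite !mulmxA BK mul1mx -mulmxA BK mulmx1.
by apply: leq_trans (mxrankM_maxl _ _) (mxrankM_maxr _ _).
Qed.

Lemma isomorphic_sym (k : fieldType) (X Y : functor_of_points k) :
  isomorphic X Y -> isomorphic Y X.
Proof.
move=> [F [bF nF]].
have inv (A : comAlgType k) : {g : Y A -> X A | cancel (F A) g & cancel g (F A)}.
  by apply: cid2; case: (bF A) => g FK gK; exists g.
exists (fun A => s2val (inv A)); split=> [A|A B f x].
  by exists (F A); [exact: (s2valP' (inv A)) | exact: (s2valP (inv A))].
apply: (can_inj (s2valP (inv B))).
by rewrite (s2valP' (inv B)) nF (s2valP' (inv A)).
Qed.

Lemma isomorphic_trans (k : fieldType) (X Y Z : functor_of_points k) :
  isomorphic X Y -> isomorphic Y Z -> isomorphic X Z.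
Proof.
move=> [F [bF nF]] [G [bG nG]]; exists (fun A => G A \o F A); split=> [A|A B f x] /=.
  exact: bij_comp.
by rewrite nF nG.
Qed.

Lemma isomorphic_refl (k : fieldType) (X : functor_of_points k) : isomorphic X X.
Proof. by exists (fun A => id); split=> // A; exists id. Qed.

Section FieldAlgebra.
Variables (k : fieldType) (A : comAlgType k).

Lemma scalar_lreg (c : k) : c != 0 -> GRing.lreg (c%:A : A).
Proof.
move=> c0 x y; rewrite -!scalerAl !mul1r => /(congr1 ( *:%R c^-1)).
by rewrite !scalerA mulVf // !scale1r.
Qed.

Lemma natr_residue_neq0 (n : nat) : n%:R != 0 :> k ->
  forall (K : fieldType) (f : {rmorphism A -> K}), n%:R != 0 :> K.
Proof.
move=> n0 K f; apply/eqP => nK.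
have : f ((n%:R : k)%:A * ((n%:R)^-1)%:A) = 1.
  by rewrite -scalerAl mul1r scalerA mulfV // scale1r rmorph1.
rewrite scaler_nat rmorphM rmorph_nat nK mul0r => /esym/eqP.
by rewrite oner_eq0.
Qed.

End FieldAlgebra.

(** With generators l of L and h of M and vectors dual to them, s could be rewritten with l or h in
    front by anticommutation. Here the rows of e and g stand for multiples of the generators, the
    standard basis for multiples of the dual vectors, and the two traces for the pairings equal to
    1. *)
Lemma clifford_image_of_traces (A : comNzRingType) (b : bool) (U : set 'rV[A]_(5 + 5))
    (e g : 'M[A]_4) (s : spinor A) :
  \tr e = 1 -> \tr g = 1 -> half_spin b s ->
  (forall i, U (row i e *m inE4 A)) -> (forall j, U (row j g *m inF4 A)) ->
  (forall i j, clifford (row i e *m inE4 A) (clifford (row j g *m inF4 A) s) = 0) ->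
  clifford_image b U s.
Proof.
move=> tre trg hs Ue Ug es.
pose l i := row i e *m inE4 A; pose h j := row j g *m inF4 A.
pose phi (i : 'I_4) := row i 1%:M *m inF4 A; pose eps (j : 'I_4) := row j 1%:M *m inE4 A.
have dot1 (M : 'M[A]_4) i : (row i M *m (row i 1%:M)^T) 0 0 = M i i.
  by rewrite row1 trmx_delta -colE !mxE.
have pol_phi i : qpolar (phi i) (l i) = e i i.
  by rewrite qpolarC qpolar_inE4F dot1.
have pol_eps j : qpolar (eps j) (h j) = g j j.
  by rewrite qpolar_inE4F -dot1 !mxE; apply: eq_bigr => x _; rewrite !mxE mulrC.
have pol_el i j : qpolar (eps j) (l i) = 0 by exact: qpolar_inE4E.
have hs' t v : half_spin b t -> half_spin (~~ b) (clifford v t).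
  exact: clifford_half_spin.
have hs'' t v : half_spin (~~ b) t -> half_spin b (clifford v t).
  by rewrite -{2}[b]negbK; exact: clifford_half_spin.
(* The anticommutator of [eps j] and [h j] is the scalar [g j j], and these add up to \tr g = 1. *)
have {1}-> : s = \sum_j (clifford (eps j) (clifford (h j) s) + clifford (h j) (clifford (eps j) s)).
  under eq_bigr do rewrite clifford_anticomm pol_eps.
  by rewrite -scaler_suml -/(mxtrace g) trg scale1r.
apply: linspan_sum => j; apply: linspanD; last first.
  by apply: clifford_image_mem; [exact: Ug | exact: hs'].
(* The same with \tr e = 1; the other half of the anticommutator dies because [l i] kills
   [clifford (h j) s]. *)
have -> : clifford (h j) s = \sum_i clifford (l i) (clifford (phi i) (clifford (h j) s)).
  transitivity ((\sum_i e i i) *: clifford (h j) s).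
    by rewrite -/(mxtrace e) tre scale1r.
  rewrite scaler_suml; apply: eq_bigr => i _.
  by rewrite -pol_phi -clifford_anticomm es clifford0r add0r.
rewrite clifford_sumr; apply: linspan_sum => i.
(* [eps j] and [l i] both lie in E, so they anticommute and [l i], a vector of U, comes to the
   front. *)
rewrite clifford_polar0 // -cliffordNr; apply: clifford_image_mem; first exact: Ue.
by rewrite -scaleN1r -cliffordZl; apply/hs'/hs''/hs'.
Qed.

(** * From a point of the zero locus back to a flag *)

Section Surjectivity.
Variables (A : comNzRingType) (U : set 'rV[A]_(5 + 5)) (e : 'M[A]_(5 + 5)).
Hypotheses (ee : e *m e = e) (Ue : U = rowspace e)
  (rk_e : forall (K : fieldType) (f : {rmorphism A -> K}), \rank (map_mx f e) = 2%N).
Hypothesis minE : forall u v, U u -> U v -> forall i j, (i < 5)%N -> (j < 5)%N ->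
  coord_e u i * coord_e v j = coord_e v i * coord_e u j.
Hypothesis minF : forall u v, U u -> U v -> forall i j, (i < 5)%N -> (j < 5)%N ->
  coord_f u i * coord_f v j = coord_f v i * coord_f u j.
Hypothesis minE4 : forall u v, U u -> U v -> forall j, (j < 5)%N ->
  coord_e u 4 * coord_f v j = coord_e v 4 * coord_f u j.
Hypothesis minF4 : forall u v, U u -> U v -> forall i, (i < 5)%N ->
  coord_e u i * coord_f v 4 = coord_e v i * coord_f u 4.
Hypothesis pairing : forall u v, U u -> U v -> low_pairing u v + coord_f u 4 * coord_e v 4 = 0.

(** At a field that kills [J], the mixed minors with indices below 4 vanish, and the section
    hypotheses supply all other 2 x 2 minors of e: the rank would be at most one instead of two. *)
Lemma mixed_minors_unit (J : set A) : ideal J ->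
  (forall u v, U u -> U v -> forall i j, (i < 4)%N -> (j < 4)%N ->
     J (coord_e u i * coord_f v j - coord_e v i * coord_f u j)) -> J 1.
Proof.
move=> iJ mJ; apply: ideal_unit => // K f fJ.
suff : (\rank (map_mx f e) <= 1)%N by rewrite rk_e.
have mEF u v i j : U u -> U v -> (i < 5)%N -> (j < 5)%N ->
    f (coord_e u i * coord_f v j) = f (coord_e v i * coord_f u j).
  move=> Uu Uv; rewrite [(i < 5)%N]leq_eqVlt ltnS [(j < 5)%N]leq_eqVlt ltnS.
  case: eqP => [[->]|_] /=; first by move=> _ j5; rewrite minE4 // ltnS leq_eqVlt.
  case: (_ =P 5) => [[->]|_] /= i4; first by move=> _; rewrite minF4 // ltnW.
  move=> j4; apply/eqP; rewrite -subr_eq0 -rmorphB; apply/eqP.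
  by apply: fJ; exact: mJ.
apply: rank_le1_minors => i j c d.
have colE (u : 'rV[A]_(5 + 5)) (x : 'I_5) :
    u 0 (lshift 5 x) = coord_e u x /\ u 0 (rshift 5 x) = coord_f u x.
  by rewrite /coord_e /coord_f inord_val.
have Ui : U (row i e) by rewrite Ue; exact: rowspace_row.
have Uj : U (row j e) by rewrite Ue; exact: rowspace_row.
have ent x y : map_mx f e x y = f ((row x e) 0 y) by rewrite !mxE.
rewrite !ent -!rmorphM.
case: (split_ordP c) => x ->; case: (split_ordP d) => y ->.
- by rewrite !(proj1 (colE _ _)) minE // mulrC.
- by rewrite !(proj1 (colE _ _)) !(proj2 (colE _ _)) mEF // mulrC.
- by rewrite !(proj1 (colE _ _)) !(proj2 (colE _ _)) mulrC -mEF //.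
- by rewrite !(proj2 (colE _ _)) minF // mulrC.
Qed.

(** Every mixed minor annihilates both coordinates: [minE] trades the index 4 of u for that of v or
    w, and what remains vanishes by [minE4]; likewise with [minF] and [minF4]. *)
Lemma last_coords0 u : U u -> coord_e u 4 = 0 /\ coord_f u 4 = 0.
Proof.
move=> Uu; pose J := [set c : A | c * coord_e u 4 = 0 /\ c * coord_f u 4 = 0].
suff [] : J 1 by rewrite !mul1r.
apply: mixed_minors_unit => [|v w Uv Uw i j i4 j4].
  split=> [|x y [x1 x2] [y1 y2]|a x [x1 x2]]; first by split; rewrite mul0r.
  - by split; rewrite mulrDl ?x1 ?x2 ?y1 ?y2 addr0.
  - by split; rewrite -mulrA ?x1 ?x2 mulr0.
have [i5 j5] : (i < 5)%N /\ (j < 5)%N by split; exact: ltnW.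
split.
  have -> : (coord_e v i * coord_f w j - coord_e w i * coord_f v j) * coord_e u 4 =
    (coord_e u 4 * coord_e v i) * coord_f w j - (coord_e u 4 * coord_e w i) * coord_f v j by ring.
  rewrite !(minE Uu) // -[RHS](mulr0 (coord_e u i)) -(subrr (coord_e v 4 * coord_f w j)).
  by rewrite {2}(minE4 Uv) //; ring.
have -> : (coord_e v i * coord_f w j - coord_e w i * coord_f v j) * coord_f u 4 =
  (coord_f u 4 * coord_f w j) * coord_e v i - (coord_f u 4 * coord_f v j) * coord_e w i by ring.
rewrite !(minF Uu) // -[RHS](mulr0 (coord_f u j)) -(subrr (coord_e v i * coord_f w 4)).
by rewrite {2}(minF4 Uv) //; ring.
Qed.

Lemma lowE_coord (u : 'rV[A]_(5 + 5)) (i : 'I_4) : (u *m (inE4 A)^T) 0 i = coord_e u i.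
Proof.
rewrite mul_inE4T mxE; congr (u _ (lshift _ _)); apply: val_inj.
by rewrite /= inordK // ltnW // ltnS.
Qed.

Lemma lowF_coord (u : 'rV[A]_(5 + 5)) (i : 'I_4) : (u *m (inF4 A)^T) 0 i = coord_f u i.
Proof.
rewrite mul_inF4T mxE; congr (u _ (rshift _ _)); apply: val_inj.
by rewrite /= inordK // ltnW // ltnS.
Qed.

Lemma U_linear a u v : U u -> U v -> U (a *: u + v).
Proof. by rewrite Ue; exact: rowspace_linear. Qed.

Lemma U0 : U 0. Proof. by rewrite Ue; exists 0 => //; rewrite mul0mx. Qed.

Lemma U_decomp u : U u ->
  u = u *m (inE4 A)^T *m inE4 A + u *m (inF4 A)^T *m inF4 A.
Proof. by move=> /last_coords0[]; exact: low_decomp. Qed.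

(** This splits U as L + M. The scalars that bring the E4-component of u into U form an ideal, and
    it contains the mixed minors. *)
Lemma U_lowE u : U u -> U (u *m (inE4 A)^T *m inE4 A).
Proof.
move=> Uu; pose J := [set c : A | U (c *: (u *m (inE4 A)^T *m inE4 A))].
suff : J 1 by rewrite /J /= scale1r.
apply: mixed_minors_unit => [|v w Uv Uw i j i4 j4].
  split=> [|x y Jx Jy|a x Jx]; rewrite /J /=.
  - by rewrite scale0r; exact: U0.
  - by rewrite scalerDl -[x *: _]scale1r; exact: U_linear.
  - by rewrite -scalerA -[X in U X]addr0; apply: U_linear => //; exact: U0.
have [i5 j5] : (i < 5)%N /\ (j < 5)%N by split; exact: ltnW.
have sw (x : 'rV[A]_(5 + 5)) : U x ->
    coord_e x i *: (u *m (inE4 A)^T) = coord_e u i *: (x *m (inE4 A)^T).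
  move=> Ux; apply/rowP => l; rewrite mxE [RHS]mxE !lowE_coord mulrC [RHS]mulrC.
  have l5 : (l < 5)%N by rewrite ltnW // ltnS.
  by rewrite minE.
rewrite /J /=.
(* By [sw] the E4-component of u, times [coord_e v i], is [coord_e u i] times that of v, and
   similarly for w. The F4-components of the two terms on the right agree by [minF], so the
   combination of v and w is its own E4-component. *)
have -> : (coord_e v i * coord_f w j - coord_e w i * coord_f v j) *: (u *m (inE4 A)^T *m inE4 A) =
    coord_e u i *: (coord_f w j *: v - coord_f v j *: w).
  rewrite [X in coord_f w j *: X](U_decomp Uv) [X in coord_f v j *: X](U_decomp Uw).
  have -> : coord_f w j *: (v *m (inE4 A)^T *m inE4 A + v *m (inF4 A)^T *m inF4 A) -
      coord_f v j *: (w *m (inE4 A)^T *m inE4 A + w *m (inF4 A)^T *m inF4 A) =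
      (coord_f w j *: (v *m (inE4 A)^T) - coord_f v j *: (w *m (inE4 A)^T)) *m inE4 A.
    have hF : coord_f w j *: (v *m (inF4 A)^T) = coord_f v j *: (w *m (inF4 A)^T).
      apply/rowP => l; rewrite mxE [RHS]mxE !lowF_coord mulrC [RHS]mulrC.
      by rewrite minF // ltnW // ltnS.
    rewrite !scalerDr opprD addrACA mulmxBl -!scalemxAl.
    by rewrite [X in _ + (X - _)]scalemxAl hF -scalemxAl subrr addr0.
  rewrite scalemxAl [RHS]scalemxAl; congr (_ *m _).
  rewrite scalerBr !(scalerA (coord_e u i)) ![coord_e u i * _]mulrC.
  rewrite -!(scalerA _ (coord_e u i)) -!sw //.
  by rewrite !scalerA -scalerBl mulrC [coord_f v j * _]mulrC.
rewrite -[X in U X]addr0; apply: U_linear; last exact: U0.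
rewrite -[coord_f v j]opprK scaleNr opprK addrC; apply: U_linear => //.
by rewrite -[X in U X]addr0; apply: U_linear => //; exact: U0.
Qed.

Lemma U_lowF u : U u -> U (u *m (inF4 A)^T *m inF4 A).
Proof.
move=> Uu; have -> : u *m (inF4 A)^T *m inF4 A = (-1) *: (u *m (inE4 A)^T *m inE4 A) + u.
  by rewrite {3}(U_decomp Uu) scaleN1r addKr.
by apply: U_linear => //; exact: U_lowE.
Qed.

(** Compressions of e to E4 and F4. They are idempotent because U contains the components of its
    vectors, which e therefore fixes. *)
Let eL := inE4 A *m e *m (inE4 A)^T.
Let eh := inF4 A *m e *m (inF4 A)^T.

Let UK u : U u -> u *m e = u. Proof. by rewrite Ue => /rowspaceP; exact. Qed.

Let UeM m (M : 'M[A]_(m, 5 + 5)) i : U (row i (M *m e)).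
Proof. by rewrite Ue row_mul; exists (row i M). Qed.

Lemma lowE_eL u : U u -> u *m (inE4 A)^T *m eL = u *m (inE4 A)^T.
Proof.
move=> Uu; rewrite /eL !mulmxA (UK (U_lowE Uu)).
by rewrite -mulmxA inE4K mulmx1.
Qed.

Lemma lowF_eh u : U u -> u *m (inF4 A)^T *m eh = u *m (inF4 A)^T.
Proof.
move=> Uu; rewrite /eh !mulmxA (UK (U_lowF Uu)).
by rewrite -mulmxA inF4K mulmx1.
Qed.

Lemma eL_idem : eL *m eL = eL.
Proof. by apply/row_matrixP => i; rewrite row_mul /eL row_mul -/eL lowE_eL. Qed.

Lemma eh_idem : eh *m eh = eh.
Proof. by apply/row_matrixP => i; rewrite row_mul /eh row_mul -/eh lowF_eh. Qed.

Lemma eL_eh_orth : eL *m eh^T = 0.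
Proof.
apply/matrixP => i j; rewrite [RHS]mxE.
have -> : (eL *m eh^T) i j = (row i eL *m (row j eh)^T) 0 0.
  by rewrite !mxE; apply: eq_bigr => x _; rewrite !mxE.
rewrite dot4E /eL /eh [row i _]row_mul [row j _]row_mul.
set u := row i (inE4 A *m e); set v := row j (inF4 A *m e).
have [Uu Uv] : U u /\ U v by split; exact: UeM.
have := pairing Uv Uu; have [_ ->] := last_coords0 Uv; rewrite mul0r addr0 => <-.
by rewrite !lowE_coord !lowF_coord !inordK // /low_pairing; ring.
Qed.

Lemma rowspace_plane_low : U = rowspace (plane_mx eL eh).
Proof.
apply/seteqP; split=> [u Uu|_ [w _ <-]].
  exists u => //; rewrite {1}(U_decomp Uu) low_mul_plane_mx lowE_eL // lowF_eh //.
  by rewrite -U_decomp.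
have -> : w *m plane_mx eL eh = w *m (inE4 A)^T *m inE4 A *m e *m (inE4 A)^T *m inE4 A +
    w *m (inF4 A)^T *m inF4 A *m e *m (inF4 A)^T *m inF4 A.
  by rewrite /plane_mx /eL /eh mulmxDr !mulmxA.
rewrite -[X in U (X + _)]scale1r; apply: U_linear.
  by apply: U_lowE; rewrite Ue; exists (w *m (inE4 A)^T *m inE4 A).
by apply: U_lowF; rewrite Ue; exists (w *m (inF4 A)^T *m inF4 A).
Qed.

(** The minors bound each rank by one. The sum is the rank of [plane_mx eL eh], through which e
    factors, so it is at least two. *)
Lemma rank_low (K : fieldType) (f : {rmorphism A -> K}) :
  \rank (map_mx f eL) = 1%N /\ \rank (map_mx f eh) = 1%N.
Proof.
have eP : e *m plane_mx eL eh = e.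
  apply/row_matrixP => i; rewrite row_mul.
  apply/rowspaceP; first by apply: plane_mx_idem; [exact: eL_idem | exact: eh_idem].
  by rewrite -rowspace_plane_low Ue; exact: rowspace_row.
have rkP : (2 <= \rank (map_mx f eL) + \rank (map_mx f eh))%N.
  rewrite -rank_plane_mx -map_plane_mx -{1}(rk_e f) -{1}eP map_mxM.
  exact: mxrankM_maxr.
have lt45 (c : 'I_4) : (c < 5)%N by apply: leq_trans (ltn_ord c) _.
have rL : (\rank (map_mx f eL) <= 1)%N.
  have ent x y : map_mx f eL x y = f (coord_e (row x (inE4 A *m e)) y).
    by rewrite -lowE_coord -row_mul mxE [in RHS]mxE.
  apply: rank_le1_minors => i j c d; rewrite !ent -!rmorphM; congr (f _).
  by rewrite (minE (UeM _ i) (UeM _ j) (lt45 c) (lt45 d)) mulrC.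
have rh : (\rank (map_mx f eh) <= 1)%N.
  have ent x y : map_mx f eh x y = f (coord_f (row x (inF4 A *m e)) y).
    by rewrite -lowF_coord -row_mul mxE [in RHS]mxE.
  apply: rank_le1_minors => i j c d; rewrite !ent -!rmorphM; congr (f _).
  by rewrite (minF (UeM _ i) (UeM _ j) (lt45 c) (lt45 d)) mulrC.
by move: rkP rL rh; case: (\rank _) => [|[|?]]; case: (\rank _) => [|[|?]].
Qed.

Lemma plane_surj : exists L H : set 'rV[A]_4,
  [/\ subbundle 1 L, subbundle 3 H, L `<=` H & plane L H = U].
Proof.
have gg : (1%:M - eh^T) *m (1%:M - eh^T) = 1%:M - eh^T.
  by rewrite mulmxBr mulmx1 mulmxBl mul1mx -trmx_mul eh_idem subrr subr0.
(* [rowspace eh] is the line M; the complement of the transposed projector has the annihilator of M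
   as its image. *)
exists (rowspace eL), (rowspace (1%:M - eh^T)); split.
- by exists eL; split=> // [|K f]; [exact: eL_idem | case: (rank_low f)].
- exists (1%:M - eh^T); split=> // K f.
  rewrite map_mxB map_mx1 rank_idempotent_compl -?map_mxM -?trmx_mul ?eh_idem //.
  by rewrite -map_trmx mxrank_tr; case: (rank_low f) => _ ->.
- move=> l /(rowspaceP _ eL_idem) lE; apply/rowspaceP => //.
  by rewrite mulmxBr mulmx1 -lE -mulmxA eL_eh_orth mulmx0 subr0.
- rewrite plane_rowspace ?eL_idem // opprB addrC subrK trmxK.
  by rewrite -rowspace_plane_low.
Qed.

End Surjectivity.

(** * From a flag to a point of the zero locus *)

Section FlagPlane.
Variable A : comNzRingType.
Implicit Types L H : set 'rV[A]_4.

Lemma idempotent_tr_complement n (g : 'M[A]_n) r :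
  g *m g = g ->
  (forall (K : fieldType) (f : {rmorphism A -> K}), \rank (map_mx f g) = r) ->
  let g' := (1%:M - g)^T in g' *m g' = g' /\
  forall (K : fieldType) (f : {rmorphism A -> K}), \rank (map_mx f g') = (n - r)%N.
Proof.
move=> gg rg g'; split.
  by rewrite -trmx_mul mulmxBr mulmx1 mulmxBl mul1mx gg subrr subr0.
move=> K f; rewrite -map_trmx mxrank_tr map_mxB map_mx1.
by rewrite rank_idempotent_compl ?rg // -map_mxM gg.
Qed.

Lemma plane_isotropic L H : subbundle 1 L -> subbundle 3 H -> L `<=` H ->
  isotropic_plane (plane L H).
Proof.
move=> [e [ee -> re]] [g [gg -> rg]] LH.
have [g'g' rg'] := idempotent_tr_complement gg rg.
split.
  exists (plane_mx e (1%:M - g)^T); split.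
  - exact: plane_mx_idem.
  - exact: plane_rowspace.
  - by move=> K f; rewrite map_plane_mx rank_plane_mx re rg'.
move=> _ [l [h [/LH Hl hH ->]]].
by rewrite qform_low -[l]trmxK -trmx_mul mxE hH // mxE.
Qed.

Lemma clifford2_plane_even_nf (l h : 'rV[A]_4) (p r : A) : l *m h^T = 0 ->
  clifford (l *m inE4 A) (clifford (h *m inF4 A) (even_nf p r)) = 0.
Proof.
move/rowP/(_ 0); rewrite dot4E [RHS]mxE => lh.
apply: spinor_bitsP => b0 b1 b2 b3 b4; rewrite clifford2_even_nf [RHS]ffunE.
rewrite /minor_ee /minor_ff /minor_ef /low_pairing.
rewrite !coord_e_inE4 // !coord_f_inE4 !coord_f_inF4 // !coord_e_inF4 /=.
case: b0; case: b1; case: b2; case: b3; case: b4; try ring.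
by rewrite -[RHS](mulr0 r) -[X in _ = r * X]lh; ring.
Qed.

Lemma clifford2_plane_odd_nf (l h : 'rV[A]_4) (p r : A) : l *m h^T = 0 ->
  clifford (l *m inE4 A) (clifford (h *m inF4 A) (odd_nf p r)) = 0.
Proof.
move/rowP/(_ 0); rewrite dot4E [RHS]mxE => lh.
apply: spinor_bitsP => b0 b1 b2 b3 b4; rewrite clifford2_odd_nf [RHS]ffunE.
rewrite /minor_ee /minor_ff /minor_ef /low_pairing.
rewrite !coord_e_inE4 // !coord_f_inE4 !coord_f_inF4 // !coord_e_inF4 /=.
case: b0; case: b1; case: b2; case: b3; case: b4; try ring.
by rewrite -[RHS](mulr0 r) -[X in _ = r * X]lh; ring.
Qed.

(** Rank one makes the traces of the projectors onto L and onto the annihilator of H equal to 1,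
    which is where 2 must not vanish. The rows of the two projectors are orthogonal because L lies
    in H. *)
Lemma plane_clifford_image L H b (s : spinor A) :
  (forall (K : fieldType) (f : {rmorphism A -> K}), 2%:R != 0 :> K) ->
  subbundle 1 L -> subbundle 3 H -> L `<=` H -> half_spin b s ->
  (forall l h : 'rV[A]_4, l *m h^T = 0 ->
     clifford (l *m inE4 A) (clifford (h *m inF4 A) s) = 0) ->
  clifford_image b (plane L H) s.
Proof.
move=> char2 [e [ee -> re]] [g [gg -> rg]] LH hs lhs.
have [g'g' rg'] := idempotent_tr_complement gg rg.
have eg : e *m (1%:M - g) = 0.
  apply/row_matrixP => i; rewrite row_mul linear0.
  have /LH/(rowspaceP _ gg) := rowspace_row e i.
  by rewrite mulmxBr mulmx1 => ->; rewrite subrr.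
apply: (@clifford_image_of_traces _ _ _ e (1%:M - g)^T) => //.
- exact: rank_one_trace.
- exact: rank_one_trace.
- move=> i; exists (row i e), 0; split.
  + exact: rowspace_row.
  + by move=> x _; rewrite mul0mx.
  + by rewrite mul0mx addr0.
- move=> j; exists 0, (row j (1%:M - g)^T); split.
  + by exists 0 => //; rewrite mul0mx.
  + move=> _ [x _ <-]; rewrite -row_mul trmx_mul mulmxA -trmx_mul.
    by rewrite mulmxBr mulmx1 gg subrr trmx0 mul0mx row0.
  + by rewrite mul0mx add0r.
- move=> i j; apply: lhs; rewrite tr_row trmxK colE mulmxA -row_mul eg row0.
  by rewrite mul0mx.
Qed.

Lemma plane_inj L H L' H' : subbundle 1 L -> subbundle 3 H ->
  subbundle 1 L' -> subbundle 3 H' -> plane L H = plane L' H' -> L = L' /\ H = H'.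
Proof.
(* Annihilators reverse inclusions: one inclusion of planes compares the lines in one direction and
   the hyperplanes in the other, and symmetry gives the rest. *)
suff sub L1 H1 L2 H2 : subbundle 1 L1 -> subbundle 3 H1 -> subbundle 1 L2 ->
    subbundle 3 H2 -> plane L1 H1 = plane L2 H2 -> L1 `<=` L2 /\ H2 `<=` H1.
  move=> sL sH sL' sH' e; have [a b] := sub _ _ _ _ sL sH sL' sH' e.
  by have [c d] := sub _ _ _ _ sL' sH' sL sH (esym e); split; apply/seteqP.
have proj (l h l' h' : 'rV[A]_4) :
    l *m inE4 A + h *m inF4 A = l' *m inE4 A + h' *m inF4 A -> l = l' /\ h = h'.
  move=> E; split.
    have := congr1 (mulmx^~ (inE4 A)^T) E.
    by rewrite !mulmxDl -!mulmxA !inE4K !inF4E !mulmx1 !mulmx0 !addr0.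
  have := congr1 (mulmx^~ (inF4 A)^T) E.
  by rewrite !mulmxDl -!mulmxA !inE4F !inF4K !mulmx1 !mulmx0 !add0r.
move=> [e1 [ee1 L1E _]] [g1 [gg1 H1E _]] [e2 [ee2 L2E _]] [g2 [gg2 H2E _]] P12.
split=> [l Ll|v Hv].
  have : plane L1 H1 (l *m inE4 A + 0 *m inF4 A).
    by exists l, 0; split=> // x _; rewrite mul0mx.
  by rewrite P12 => -[l' [h' [Ll' _ /proj[-> _]]]].
rewrite H1E; apply/(rowspaceP _ gg1).
apply/eqP; rewrite eq_sym -subr_eq0 -{1}[v]mulmx1 -mulmxBr -trmx_eq0 trmx_mul; apply/eqP.
apply/row_matrixP => i; rewrite row_mul row0.
have : plane L1 H1 (0 *m inE4 A + row i (1%:M - g1)^T *m inF4 A).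
  exists 0, (row i (1%:M - g1)^T); split=> // [|x].
    by rewrite L1E; exists 0 => //; rewrite mul0mx.
  rewrite H1E => -[y _ <-]; rewrite -row_mul trmx_mul mulmxA -trmx_mul.
  by rewrite mulmxBr mulmx1 gg1 subrr trmx0 mul0mx row0.
by rewrite P12 => -[l' [h' [_ hH /proj[_ ->]]]]; exact: hH.
Qed.

End FlagPlane.

Lemma base_change_plane (A B : comNzRingType) (f : {rmorphism A -> B})
    (L H : set 'rV[A]_4) : subbundle 1 L -> subbundle 3 H ->
  plane (base_change f L) (base_change f H) = base_change f (plane L H).
Proof.
move=> [e [ee -> _]] [g [gg -> _]].
rewrite plane_rowspace // !base_change_rowspace plane_rowspace -?map_mxM ?ee ?gg //.
by rewrite map_plane_mx -map_trmx map_mxB map_mx1.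
Qed.

(** * The isomorphism for a normal form *)

Section NormalFormLocus.
Variables (k : fieldType) (p1 r1 p2 r2 : k).
Hypotheses (char6 : 6%:R != 0 :> k) (p1_0 : p1 != 0) (r1_0 : r1 != 0)
  (p2_0 : p2 != 0) (r2_0 : r2 != 0) (det_0 : p1 * r2 - p2 * r1 != 0).

Let char2 : 2%:R != 0 :> k.
Proof. by apply: contraNneq char6 => k2; rewrite (natrM _ 2 3) k2 mul0r. Qed.

Lemma const_even_nf (A : comAlgType k) p r :
  const_spinor A (even_nf p r) = even_nf p%:A r%:A.
Proof. by apply/ffunP => J; rewrite !ffunE; do 2 case: ifP => // _; rewrite scale0r. Qed.

Lemma const_odd_nf (A : comAlgType k) p r :
  const_spinor A (odd_nf p r) = odd_nf p%:A r%:A.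
Proof. by apply/ffunP => J; rewrite !ffunE; do 2 case: ifP => // _; rewrite scale0r. Qed.

Lemma plane_zero_pts (A : comAlgType k) (L H : set 'rV[A]_4) :
  [/\ subbundle 1 L, subbundle 3 H & L `<=` H] ->
  [/\ isotropic_plane (plane L H),
      clifford_image false (plane L H) (const_spinor A (even_nf p1 r1)) &
      clifford_image true (plane L H) (const_spinor A (odd_nf p2 r2))].
Proof.
move=> [sL sH LH]; rewrite const_even_nf const_odd_nf.
have c2 := @natr_residue_neq0 _ A 2 char2.
split; first exact: plane_isotropic.
- apply: plane_clifford_image => //; first exact: even_nf_half_spin.
  by move=> l h; exact: clifford2_plane_even_nf.
- apply: plane_clifford_image => //; first exact: odd_nf_half_spin.
  by move=> l h; exact: clifford2_plane_odd_nf.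
Qed.

Lemma zero_pts_plane (A : comAlgType k) (U : set 'rV[A]_(5 + 5)) :
  isotropic_plane U -> clifford_image false U (const_spinor A (even_nf p1 r1)) ->
  clifford_image true U (const_spinor A (odd_nf p2 r2)) ->
  exists L H : set 'rV[A]_4,
  [/\ subbundle 1 L, subbundle 3 H, L `<=` H & plane L H = U].
Proof.
rewrite const_even_nf const_odd_nf => iU i1 i2.
have c6 := @natr_residue_neq0 _ A 6 char6.
have ldet : GRing.lreg (p1%:A * r2%:A - p2%:A * r1%:A : A).
  rewrite -!scalerAl !mul1r !scalerA -scalerBl; exact: scalar_lreg.
have min u v Uu Uv := nf_minors (scalar_lreg p1_0) (scalar_lreg r1_0)
  (scalar_lreg p2_0) (scalar_lreg r2_0) ldet
  (isotropic_plane_kill c6 iU i1 (u := u) (v := v) Uu Uv)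
  (isotropic_plane_kill c6 iU i2 Uu Uv).
have [[e [ee Ue rk_e]] _] := iU.
by apply: (plane_surj ee Ue rk_e) => u v Uu Uv; case: (min u v Uu Uv).
Qed.

(** The transformation is written from flags to planes, where it is a formula compatible with base
    change. Its inverse is chosen pointwise, and [isomorphic_sym] makes it natural. *)
Theorem zero_locus_nf :
  isomorphic (zero_locus (even_nf p1 r1) (odd_nf p2 r2)) (Fl k 4).
Proof.
apply: isomorphic_sym.
exists (fun A (x : Fl k 4 A) => exist _ (plane (sval x).1 (sval x).2)
   (plane_zero_pts (svalP x))).
split=> [A|A B f x]; last first.
  apply: eq_exist => /=; case: x => -[L H] /= [sL sH LH].
  exact: base_change_plane.
have F_inj : injective (fun x : Fl k 4 A => exist _ (plane (sval x).1 (sval x).2)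
    (plane_zero_pts (svalP x)) : zero_locus (even_nf p1 r1) (odd_nf p2 r2) A).
  move=> [[L H] [sL sH LH]] [[L' H'] [sL' sH' LH']] /(congr1 sval) /= PP.
  apply: eq_exist => /=.
  by have [/= -> ->] := plane_inj sL sH sL' sH' PP.
have F_surj (y : zero_locus (even_nf p1 r1) (odd_nf p2 r2) A) :
    exists x : Fl k 4 A, plane (sval x).1 (sval x).2 = sval y.
  case: y => U [iU i1 i2] /=.
  have [L [H [sL sH LH PU]]] := zero_pts_plane iU i1 i2.
  by exists (exist _ (L, H) (And3 sL sH LH)).
have [g gP] := choice F_surj.
exists g => [x|y]; last first.
  by move: (gP y); move: (g y); case: y => U pU gy h; exact: eq_exist.
apply: F_inj; apply: eq_exist; exact: gP.
Qed.

End NormalFormLocus.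

(** * Isometries and spinors *)

Section Transvection.
Variable A : comNzRingType.
Implicit Types (x y v : 'rV[A]_(5 + 5)) (s t : spinor A) (c : A) (U : set 'rV[A]_(5 + 5)).

Definition isotropic_pair x y : Prop := [/\ qform x = 0, qform y = 0 & qpolar x y = 0].

(** For an isotropic pair the operator x y has square zero, so this is the exponential of c x y, an
    element of the spin group. *)
Definition spin_transv c x y s : spinor A := s + c *: clifford x (clifford y s).

(** Exchanging E and F is the matrix of the polar form: the dot product with [swap_halves x] is the
    polar form with x. *)
Definition swap_halves v : 'rV[A]_(5 + 5) := row_mx (rsubmx v) (lsubmx v).

(* The vector representation of [spin_transv c x y]: [v] is mapped to
   [v + c (<y, v> x - <x, v> y)]. *)
Definition transv_mx c x y : 'M[A]_(5 + 5) :=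
  1%:M + c *: ((swap_halves y)^T *m x - (swap_halves x)^T *m y).

Lemma qpolar_swap_halves x v : v *m (swap_halves x)^T = (qpolar x v)%:M.
Proof.
rewrite [LHS]mx11_scalar; congr (_%:M).
rewrite /swap_halves tr_row_mx -{1}[v]hsubmxK mul_row_col mxE !mxE.
rewrite /qpolar big_split addrC /=.
by congr (_ + _); apply: eq_bigr => i _; rewrite !mxE // mulrC.
Qed.

Lemma transv_mxE c x y v :
  v *m transv_mx c x y = v + c *: (qpolar y v *: x - qpolar x v *: y).
Proof.
rewrite mulmxDr mulmx1 -scalemxAr mulmxBr !mulmxA !qpolar_swap_halves.
by rewrite !mul_scalar_mx.
Qed.

Lemma qpolarZr c x y : qpolar x (c *: y) = c * qpolar x y.
Proof. by rewrite qpolarC qpolarZl qpolarC. Qed.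

Lemma qpolarDr x y v : qpolar x (y + v) = qpolar x y + qpolar x v.
Proof. by rewrite qpolarC qpolarDl !(qpolarC x). Qed.

Lemma qpolarNr x y : qpolar x (- y) = - qpolar x y.
Proof. by rewrite -scaleN1r qpolarZr mulN1r. Qed.

Lemma qformZ c x : qform (c *: x) = c ^+ 2 * qform x.
Proof. by rewrite !qformE /coord_e /coord_f !mxE; ring. Qed.

Lemma qpolarxx x : qpolar x x = 2%:R * qform x.
Proof. by rewrite qformE qpolarE; ring. Qed.

Section Pair.
Variables (c : A) (x y : 'rV[A]_(5 + 5)).
Hypothesis xy : isotropic_pair x y.

Let cxx s : clifford x (clifford x s) = 0.
Proof. by rewrite clifford_square; case: xy => -> _ _; rewrite scale0r. Qed.

Let cyy s : clifford y (clifford y s) = 0.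
Proof. by rewrite clifford_square; case: xy => _ -> _; rewrite scale0r. Qed.

Let cyx s : clifford y (clifford x s) = - clifford x (clifford y s).
Proof. by apply: clifford_polar0; rewrite qpolarC; case: xy. Qed.

Lemma spin_transvK s : spin_transv (- c) x y (spin_transv c x y s) = s.
Proof.
rewrite /spin_transv !cliffordDr !cliffordZr cyx cliffordNr cxx oppr0 scaler0 addr0.
by rewrite scaleNr addrK.
Qed.

(** Moving v past x y costs the Clifford product with the vector <y, v> x - <x, v> y, which the
    first-order change of v compensates; the term in c^2 dies because x x = y y = 0. *)
Lemma clifford_transv v s :
  clifford (v *m transv_mx c x y) (spin_transv c x y s) = spin_transv c x y (clifford v s).
Proof.
have vx t : clifford v (clifford x t) = - clifford x (clifford v t) + qpolar x v *: t.
  by rewrite -clifford_anticomm addrA [- _ + _]addrC subrr add0r.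
have vy t : clifford v (clifford y t) = - clifford y (clifford v t) + qpolar y v *: t.
  by rewrite -clifford_anticomm addrA [- _ + _]addrC subrr add0r.
set X := clifford x (clifford y s).
pose D t := qpolar y v *: clifford x t - qpolar x v *: clifford y t.
have vD t : clifford (v *m transv_mx c x y) t = clifford v t + c *: D t.
  by rewrite transv_mxE cliffordDl cliffordZl cliffordDl cliffordNl !cliffordZl.
have DX : D X = 0.
  by rewrite /D /X cxx cyx cyy clifford0r oppr0 !scaler0 subrr.
have vX : clifford v X = clifford x (clifford y (clifford v s)) - D s.
  by rewrite /X vx vy cliffordDr cliffordNr cliffordZr opprD opprK opprB addrA addrAC.
rewrite /spin_transv -/X cliffordDr cliffordZr !vD DX scaler0 addr0 vX.
by rewrite -addrA -scalerDr [D s + _]addrC subrK.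
Qed.

Lemma qform_transv v : qform (v *m transv_mx c x y) = qform v.
Proof.
case: xy => x0 y0 xy0; rewrite transv_mxE -scaleNr scalerDr !scalerA !qformD !qformZ.
rewrite qpolarDr !qpolarZr qpolarZl xy0 x0 y0 (qpolarC v x) (qpolarC v y).
by ring.
Qed.

Lemma transv_mxK : transv_mx c x y *m transv_mx (- c) x y = 1%:M.
Proof.
case: xy => x0 y0 xy0.
have K v : v *m (transv_mx c x y *m transv_mx (- c) x y) = v.
  rewrite mulmxA (transv_mxE (- c)) (transv_mxE c).
  set w := v + _.
  have -> : qpolar y w = qpolar y v.
    by rewrite /w !(qpolarDr, qpolarZr, qpolarNr) qpolarxx y0 (qpolarC y x) xy0; ring.
  have -> : qpolar x w = qpolar x v.
    by rewrite /w !(qpolarDr, qpolarZr, qpolarNr) qpolarxx x0 xy0; ring.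
  by rewrite /w scaleNr addrK.
by apply/row_matrixP => i; rewrite rowE K -row1.
Qed.

End Pair.

End Transvection.

Section MapTransvection.
Variables (A B : comNzRingType) (f : {rmorphism A -> B}).

Lemma map_transv_mx c x y :
  map_mx f (transv_mx c x y) = transv_mx (f c) (map_mx f x) (map_mx f y).
Proof.
rewrite /transv_mx map_mxD map_mx1 map_mxZ map_mxB !map_mxM -!map_trmx.
by rewrite /swap_halves !map_row_mx !map_lsubmx !map_rsubmx.
Qed.

Lemma map_spin_transv c x y s : map_spinor f (spin_transv c x y s) =
  spin_transv (f c) (map_mx f x) (map_mx f y) (map_spinor f s).
Proof.
rewrite /spin_transv -!map_clifford; apply/ffunP => J.
by rewrite [LHS]ffunE [in LHS]ffunE [in RHS]ffunE !ffunE rmorphD rmorphM.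
Qed.

Lemma map_isotropic_pair x y :
  isotropic_pair x y -> isotropic_pair (map_mx f x) (map_mx f y).
Proof.
have ecf u i : coord_e (map_mx f u) i = f (coord_e u i) by rewrite /coord_e mxE.
have fcf u i : coord_f (map_mx f u) i = f (coord_f u i) by rewrite /coord_f mxE.
move=> [x0 y0 xy0]; split.
- by rewrite qformE !ecf !fcf -!rmorphM -!rmorphD -qformE x0 rmorph0.
- by rewrite qformE !ecf !fcf -!rmorphM -!rmorphD -qformE y0 rmorph0.
- by rewrite qpolarE !ecf !fcf -!rmorphM -!rmorphD -qpolarE xy0 rmorph0.
Qed.

End MapTransvection.

Section TransvectionImage.
Variables (A : comNzRingType) (c : A) (x y : 'rV[A]_(5 + 5)).
Hypothesis xy : isotropic_pair x y.
Implicit Types U : set 'rV[A]_(5 + 5).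

Definition transv_image U : set 'rV[A]_(5 + 5) := [set u *m transv_mx c x y | u in U].

Lemma transv_image_rowspace (e : 'M[A]_(5 + 5)) :
  transv_image (rowspace e) = rowspace (transv_mx (- c) x y *m e *m transv_mx c x y).
Proof.
apply/seteqP; split=> [_ [_ [w _ <-] <-]|_ [w _ <-]].
  by exists (w *m transv_mx c x y) => //; rewrite !mulmxA -(mulmxA w) transv_mxK // mulmx1.
exists (w *m transv_mx (- c) x y *m e); last by rewrite !mulmxA.
by exists (w *m transv_mx (- c) x y).
Qed.

Lemma transv_image_subbundle r U : subbundle r U -> subbundle r (transv_image U).
Proof.
move=> [e [ee -> re]]; exists (transv_mx (- c) x y *m e *m transv_mx c x y); split.
- by rewrite !mulmxA -(mulmxA _ _ (transv_mx (- c) x y)) transv_mxK // mulmx1 -(mulmxA _ e e) ee.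
- exact: transv_image_rowspace.
- move=> K f; rewrite -(re K f) !map_mxM.
  apply/eqP; rewrite eqn_leq; apply/andP; split.
    by apply: leq_trans (mxrankM_maxl _ _) (mxrankM_maxr _ _).
  have M1 : map_mx f (transv_mx c x y) *m map_mx f (transv_mx (- c) x y) = 1%:M.
    by rewrite -map_mxM transv_mxK // map_mx1.
  set e' := map_mx f e.
  have {1}-> : e' = map_mx f (transv_mx c x y) *m (map_mx f (transv_mx (- c) x y) *m
     e' *m map_mx f (transv_mx c x y)) *m map_mx f (transv_mx (- c) x y).
    by rewrite !mulmxA M1 mul1mx -mulmxA M1 mulmx1.
  by apply: leq_trans (mxrankM_maxl _ _) (mxrankM_maxr _ _).
Qed.

Lemma transv_image_isotropic U : isotropic_plane U -> isotropic_plane (transv_image U).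
Proof.
move=> [sU oU]; split; first exact: transv_image_subbundle.
by move=> _ [u Uu <-]; rewrite qform_transv // oU.
Qed.

Lemma spin_transv_half_spin b s : half_spin b s -> half_spin b (spin_transv c x y s).
Proof.
move=> hs; have h2 : half_spin b (clifford x (clifford y s)).
  by rewrite -[b]negbK; do 2 apply: clifford_half_spin.
by move=> J bJ; rewrite ffunE hs // add0r ffunE h2 // scaler0.
Qed.

Lemma transv_image_clifford b U s : clifford_image b U s ->
  clifford_image b (transv_image U) (spin_transv c x y s).
Proof.
move=> [m [d [z [Sz ->]]]].
have -> : spin_transv c x y (\sum_i d i *: z i) = \sum_i d i *: spin_transv c x y (z i).
  rewrite /spin_transv !clifford_sumr scaler_sumr -big_split /=.
  by apply: eq_bigr => i _; rewrite !cliffordZr scalerDr !scalerA mulrC.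
exists m, d, (fun i => spin_transv c x y (z i)); split=> // i.
have [u Uu [t ht <-]] := Sz i.
exists (u *m transv_mx c x y); first by exists u.
exists (spin_transv c x y t); first exact: spin_transv_half_spin.
by rewrite clifford_transv.
Qed.

End TransvectionImage.

Lemma transv_imageK (A : comNzRingType) (c : A) x y (U : set 'rV[A]_(5 + 5)) :
  isotropic_pair x y -> transv_image (- c) x y (transv_image c x y U) = U.
Proof.
move=> xy; apply/seteqP; split=> [_ [_ [u Uu <-] <-]|u Uu].
  by rewrite -mulmxA transv_mxK // mulmx1.
exists (u *m transv_mx c x y); first by exists u.
by rewrite -mulmxA transv_mxK // mulmx1.
Qed.

Lemma base_change_transv_image (A B : comNzRingType) (f : {rmorphism A -> B})
    (c : A) x y r (U : set 'rV[A]_(5 + 5)) : isotropic_pair x y -> subbundle r U ->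
  base_change f (transv_image c x y U) =
  transv_image (f c) (map_mx f x) (map_mx f y) (base_change f U).
Proof.
move=> xy [e [_ -> _]]; rewrite transv_image_rowspace // !base_change_rowspace.
rewrite transv_image_rowspace; last exact: map_isotropic_pair.
by rewrite !map_mxM !map_transv_mx rmorphN.
Qed.

Lemma clifford_half_part (A : comNzRingType) b (x : 'rV[A]_(5 + 5)) s :
  clifford x (half_part b s) = half_part (~~ b) (clifford x s).
Proof.
apply/ffunP => J; rewrite [RHS]ffunE; case: ifP => oJ.
  rewrite !ffunE; apply: eq_bigr => i _; case: ifP => iJ; congr (_ * (_ * _)).
    rewrite ffunE (_ : (_ == b) = true) //.
    by move: oJ; rewrite (cardsD1 i J) iJ /=; case: (odd _); case: (b).
  rewrite ffunE (_ : (_ == b) = true) // cardsU1 iJ /=.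
  by move: oJ; case: (odd _); case: (b).
apply: (@clifford_half_spin A b); last by rewrite oJ.
by move=> I oI; rewrite ffunE (negbTE oI).
Qed.

Lemma half_part_transv (A : comNzRingType) b (c : A) x y s :
  half_part b (spin_transv c x y s) = spin_transv c x y (half_part b s).
Proof.
rewrite /spin_transv !clifford_half_part negbK; apply/ffunP => J.
rewrite !(ffunE (fun _ => if _ then _ else _)) !ffunE.
by case: ifP => // _; rewrite ?scaler0 ?addr0.
Qed.

Section TransvectionLocus.
Variables (k : fieldType) (c : k) (x y : 'rV[k]_(5 + 5)).
Hypothesis xy : isotropic_pair x y.

Lemma const_spin_transv (A : comAlgType k) (a : k) (s : spinor k) :
  const_spinor A (spin_transv a x y s) =
  spin_transv (a%:A : A) (map_mx (in_alg A) x) (map_mx (in_alg A) y) (const_spinor A s).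
Proof. exact: (map_spin_transv (in_alg A)). Qed.

Local Notation Z s := (zero_locus (half_part false s) (half_part true s)).

Lemma transv_zero_pts (A : comAlgType k) (a : k) (s : spinor k) (U : set 'rV[A]_(5 + 5)) :
  [/\ isotropic_plane U, clifford_image false U (const_spinor A (half_part false s)) &
        clifford_image true U (const_spinor A (half_part true s))] ->
  let U' := transv_image (a%:A : A) (map_mx (in_alg A) x) (map_mx (in_alg A) y) U in
  [/\ isotropic_plane U',
    clifford_image false U' (const_spinor A (half_part false (spin_transv a x y s))) &
    clifford_image true U' (const_spinor A (half_part true (spin_transv a x y s)))].
Proof.
have xyA := map_isotropic_pair (in_alg A) xy.
move=> [iU i1 i2] U'; rewrite !half_part_transv !const_spin_transv; split.
- exact: transv_image_isotropic.
- exact: transv_image_clifford.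
- exact: transv_image_clifford.
Qed.

(** As c, x and y come from the ground field, the isometry commutes with base change; its inverse
    has the parameter [- c]. *)
Lemma zero_locus_transv (s : spinor k) : isomorphic (Z s) (Z (spin_transv c x y s)).
Proof.
exists (fun A (U : Z s A) => exist _
  (transv_image (c%:A : A) (map_mx (in_alg A) x) (map_mx (in_alg A) y) (sval U))
  (transv_zero_pts c (svalP U)) : Z (spin_transv c x y s) A).
split=> [A|A B f [U pU]]; last first.
  apply: eq_exist => /=; have [[sU _] _ _] := pU.
  rewrite (base_change_transv_image f _ (map_isotropic_pair (in_alg A) xy) sU).
  have fin (a : k) : f (a%:A) = a%:A by rewrite linearZ /= rmorph1.
  have fz (z : 'rV[k]_(5 + 5)) : map_mx f (map_mx (in_alg A) z) = map_mx (in_alg B) z.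
    by apply/rowP => i; rewrite !mxE; exact: fin.
  by rewrite !fz; congr (transv_image _ _ _ _); exact/esym/fin.
have xyA := map_isotropic_pair (in_alg A) xy.
pose M (U : set 'rV[A]_(5 + 5)) :=
  transv_image (- (c%:A) : A) (map_mx (in_alg A) x) (map_mx (in_alg A) y) U.
have MP (V : Z (spin_transv c x y s) A) :
    [/\ isotropic_plane (M (sval V)),
        clifford_image false (M (sval V)) (const_spinor A (half_part false s)) &
        clifford_image true (M (sval V)) (const_spinor A (half_part true s))].
  by have := transv_zero_pts (- c) (svalP V); rewrite spin_transvK // scaleNr.
exists (fun V => exist _ (M (sval V)) (MP V) : Z s A) => [[U pU]|[V pV]];
  apply: eq_exist => /=; first exact: transv_imageK.
rewrite /M -{1}[c%:A]opprK; exact: transv_imageK.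
Qed.

End TransvectionLocus.

(** * Explicit exponentials and their effect on coefficients *)

Section BasisTransvections.
Variable k : fieldType.
Implicit Types (s : spinor k) (c : k) (i j : nat) (y : bool).

(* The basis vector e_i if [y] is true, f_i otherwise. *)
Definition basis_vec y i : 'rV[k]_(5 + 5) :=
  delta_mx 0 (if y then lshift 5 (inord i) else rshift 5 (inord i)).

Lemma coord_e_basis_vec y i j : (i < 5)%N -> (j < 5)%N ->
  coord_e (basis_vec y i) j = (y && (i == j))%:R.
Proof.
move=> i5 j5; rewrite /coord_e mxE eqxx /=; case: y.
  by rewrite (inj_eq (@lshift_inj _ _)) -val_eqE /= !inordK // eq_sym.
by rewrite eq_lrshift.
Qed.

Lemma coord_f_basis_vec y i j : (i < 5)%N -> (j < 5)%N ->
  coord_f (basis_vec y i) j = (~~ y && (i == j))%:R.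
Proof.
move=> i5 j5; rewrite /coord_f mxE eqxx /=; case: y.
  by rewrite eq_rlshift.
by rewrite (inj_eq (@rshift_inj _ _)) -val_eqE /= !inordK // eq_sym.
Qed.

Lemma basis_isotropic_pair y i y' j : (i < 5)%N -> (j < 5)%N -> i != j ->
  isotropic_pair (basis_vec y i) (basis_vec y' j).
Proof.
move=> i5 j5 ij; split.
- rewrite qformE !coord_e_basis_vec // !coord_f_basis_vec //.
  by case: y; rewrite /= !(mul0r, mulr0) !addr0.
- rewrite qformE !coord_e_basis_vec // !coord_f_basis_vec //.
  by case: y'; rewrite /= !(mul0r, mulr0) !addr0.
- rewrite qpolarE !coord_e_basis_vec // !coord_f_basis_vec //.
  by move: i j i5 j5 ij => [|[|[|[|[|i]]]]] [|[|[|[|[|j]]]]] // _ _ _;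
    case: y; case: y'; rewrite /= !(mul0r, mulr0) !addr0.
Qed.

Lemma clifford_basis_vec y i s (b : seq bool) : (i < 5)%N -> size b = 5 ->
  clifford (basis_vec y i) s (bits_set b) =
  if nth false b i == y
  then (-1) ^+ count id (take i b) * s (bits_set (set_nth false b i (~~ y))) else 0.
Proof.
move=> i5 sb; rewrite cliffordE // /clifford_term !coord_e_basis_vec // !coord_f_basis_vec //.
by move: i i5 => [|[|[|[|[|i]]]]] // _; case: y; rewrite /= ?(mul0r, mulr0, addr0, add0r, mul1r);
  do 5 (rewrite ?if_same ?(mul0r, mulr0, addr0, add0r, mul1r)); case: (nth _ _ _); rewrite ?mulr0.
Qed.

Definition basis_transv c y i y' j s : spinor k :=
  spin_transv c (basis_vec y i) (basis_vec y' j) s.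

Lemma basis_transvE c y i y' j s (b : seq bool) : (i < 5)%N -> (j < 5)%N -> size b = 5 ->
  basis_transv c y i y' j s (bits_set b) = s (bits_set b) +
  if nth false b i == y then
    let b' := set_nth false b i (~~ y) in
    if nth false b' j == y' then
      (-1) ^+ (count id (take i b) + count id (take j b')) *
      (c * s (bits_set (set_nth false b' j (~~ y'))))
    else 0
  else 0.
Proof.
move=> i5 j5 sb; rewrite ffunE; congr (_ + _); rewrite ffunE clifford_basis_vec //.
case: ifP => _; last by rewrite scaler0.
rewrite /= clifford_basis_vec // ?size_set_nth ?sb; last first.
  by apply/maxn_idPr.
case: ifP => _; last by rewrite mulr0 scaler0.
by rewrite exprD /GRing.scale /=; ring.
Qed.

Lemma basis_transv0 y i y' j s : basis_transv 0 y i y' j s = s.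
Proof. by rewrite /basis_transv /spin_transv scale0r addr0. Qed.

Local Notation Z s := (zero_locus (half_part false s) (half_part true s)).

Lemma zero_locus_basis_transv c y i y' j s : (i < 5)%N -> (j < 5)%N -> i != j ->
  isomorphic (Z s) (Z (basis_transv c y i y' j s)).
Proof. by move=> i5 j5 ij; apply: zero_locus_transv; exact: basis_isotropic_pair. Qed.

(* exp of the bivector sum c_ij e_i e_j (or f_i f_j), for i < j < 4 *)
Definition bivector_exp y (c01 c02 c03 c12 c13 c23 : k) s : spinor k :=
  basis_transv c01 y 0 y 1 (basis_transv c02 y 0 y 2 (basis_transv c03 y 0 y 3
  (basis_transv c12 y 1 y 2 (basis_transv c13 y 1 y 3 (basis_transv c23 y 2 y 3 s))))).

(* exp of the product of e_4 (or f_4) by the vector sum a_i e_i + d_i f_i, i < 4 *)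
Definition mixed_exp y (a0 a1 a2 a3 d0 d1 d2 d3 : k) s : spinor k :=
  basis_transv a0 y 4 true 0 (basis_transv a1 y 4 true 1
  (basis_transv a2 y 4 true 2 (basis_transv a3 y 4 true 3
  (basis_transv d0 y 4 false 0 (basis_transv d1 y 4 false 1
  (basis_transv d2 y 4 false 2 (basis_transv d3 y 4 false 3 s))))))).

Lemma zero_locus_bivector_exp y c01 c02 c03 c12 c13 c23 s :
  isomorphic (Z s) (Z (bivector_exp y c01 c02 c03 c12 c13 c23 s)).
Proof.
do 6 (apply: isomorphic_trans; last by apply: zero_locus_basis_transv).
exact: isomorphic_refl.
Qed.

Lemma zero_locus_mixed_exp y a0 a1 a2 a3 d0 d1 d2 d3 s :
  isomorphic (Z s) (Z (mixed_exp y a0 a1 a2 a3 d0 d1 d2 d3 s)).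
Proof.
do 8 (apply: isomorphic_trans; last by apply: zero_locus_basis_transv).
exact: isomorphic_refl.
Qed.

Definition coef s (b0 b1 b2 b3 b4 : bool) : k := s (bits_set [:: b0; b1; b2; b3; b4]).

Definition transv_coef c y i y' j (f : seq bool -> k) (b : seq bool) : k := f b +
  if nth false b i == y then
    let b' := set_nth false b i (~~ y) in
    if nth false b' j == y' then
      (-1) ^+ (count id (take i b) + count id (take j b')) *
      (c * f (set_nth false b' j (~~ y')))
    else 0
  else 0.

Lemma basis_transv_coefE c y i y' j s (f : seq bool -> k) : (i < 5)%N -> (j < 5)%N ->
  (forall b, size b = 5 -> s (bits_set b) = f b) ->
  forall b, size b = 5 -> basis_transv c y i y' j s (bits_set b) = transv_coef c y i y' j f b.
Proof.
move=> i5 j5 sf b sb; rewrite basis_transvE // /transv_coef sf //.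
by congr (_ + _); case: ifP => //= _; case: ifP => //= _;
  rewrite sf // !size_set_nth sb; do 2 rewrite (maxn_idPr _) //.
Qed.

Lemma bivector_exp_coefE y c01 c02 c03 c12 c13 c23 s (b : seq bool) : size b = 5 ->
  bivector_exp y c01 c02 c03 c12 c13 c23 s (bits_set b) =
  transv_coef c01 y 0 y 1 (transv_coef c02 y 0 y 2 (transv_coef c03 y 0 y 3
  (transv_coef c12 y 1 y 2 (transv_coef c13 y 1 y 3
  (transv_coef c23 y 2 y 3 (fun b => s (bits_set b))))))) b.
Proof. by move: b; do 6 apply: basis_transv_coefE => //. Qed.

Lemma mixed_exp_coefE y a0 a1 a2 a3 d0 d1 d2 d3 s (b : seq bool) : size b = 5 ->
  mixed_exp y a0 a1 a2 a3 d0 d1 d2 d3 s (bits_set b) =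
  transv_coef a0 y 4 true 0 (transv_coef a1 y 4 true 1
  (transv_coef a2 y 4 true 2 (transv_coef a3 y 4 true 3
  (transv_coef d0 y 4 false 0 (transv_coef d1 y 4 false 1
  (transv_coef d2 y 4 false 2 (transv_coef d3 y 4 false 3
    (fun b => s (bits_set b))))))))) b.
Proof. by move: b; do 8 apply: basis_transv_coefE => //. Qed.

(** Multiplication by exp(c) in the exterior algebra of E4: scalar p, bivector x and top r become p,
    x + p c and r + c x + p Pf(c), since c^2 / 2 is the Pfaffian times e_0 e_1 e_2 e_3. *)
Lemma coef_bivector_exp_e c01 c02 c03 c12 c13 c23 s b4 :
  let t := bivector_exp true c01 c02 c03 c12 c13 c23 s in
  [/\ coef t false false false false b4 = coef s false false false false b4,
      [/\ coef t true true false false b4 =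
            coef s true true false false b4 + c01 * coef s false false false false b4,
          coef t true false true false b4 =
            coef s true false true false b4 + c02 * coef s false false false false b4 &
          coef t true false false true b4 =
            coef s true false false true b4 + c03 * coef s false false false false b4],
      [/\ coef t false true true false b4 =
            coef s false true true false b4 + c12 * coef s false false false false b4,
          coef t false true false true b4 =
            coef s false true false true b4 + c13 * coef s false false false false b4 &
          coef t false false true true b4 =
            coef s false false true true b4 + c23 * coef s false false false false b4] &
      coef t true true true true b4 = coef s true true true true b4 +
        (c01 * coef s false false true true b4 - c02 * coef s false true false true b4 +
         c03 * coef s false true true false b4 + c12 * coef s true false false true b4 -
         c13 * coef s true false true false b4 + c23 * coef s true true false false b4) +
        (c01 * c23 - c02 * c13 + c03 * c12) * coef s false false false false b4].
Proof.
have E b := @bivector_exp_coefE true c01 c02 c03 c12 c13 c23 s b.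
rewrite /coef /=; split; [|split|split|]; rewrite E // /transv_coef /=; ring.
Qed.

(** The dual formula, with top and scalar exchanged. Contraction of the top form leaves the
    complementary pair of indices, hence the permuted parameters and the signs. *)
Lemma coef_bivector_exp_f c01 c02 c03 c12 c13 c23 s b4 :
  let t := bivector_exp false c01 c02 c03 c12 c13 c23 s in
  [/\ coef t true true true true b4 = coef s true true true true b4,
      [/\ coef t true true false false b4 =
            coef s true true false false b4 - c23 * coef s true true true true b4,
          coef t true false true false b4 =
            coef s true false true false b4 + c13 * coef s true true true true b4 &
          coef t true false false true b4 =
            coef s true false false true b4 - c12 * coef s true true true true b4],
      [/\ coef t false true true false b4 =
            coef s false true true false b4 - c03 * coef s true true true true b4,
          coef t false true false true b4 =
            coef s false true false true b4 + c02 * coef s true true true true b4 &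
          coef t false false true true b4 =
            coef s false false true true b4 - c01 * coef s true true true true b4] &
      coef t false false false false b4 = coef s false false false false b4 -
        (c01 * coef s true true false false b4 + c02 * coef s true false true false b4 +
         c03 * coef s true false false true b4 + c12 * coef s false true true false b4 +
         c13 * coef s false true false true b4 + c23 * coef s false false true true b4) +
        (c01 * c23 - c02 * c13 + c03 * c12) * coef s true true true true b4].
Proof.
have E b := @bivector_exp_coefE false c01 c02 c03 c12 c13 c23 s b.
rewrite /coef /=; split; [|split|split|]; rewrite E // /transv_coef /=; ring.
Qed.

(** Write s = s' + s'' e_4 with s', s'' in the exterior algebra of E4; the bit [b4] selects s' or
    s''. Here and in [odd_zero], parity is that of the degree in E4, so [odd_zero s true] concerns
    the even half-spinor and [even_mid_zero s true] the odd one. *)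
Definition even_mid_zero s b4 : Prop :=
  [/\ coef s true true false false b4 = 0, coef s true false true false b4 = 0 &
      coef s true false false true b4 = 0] /\
  [/\ coef s false true true false b4 = 0, coef s false true false true b4 = 0 &
      coef s false false true true b4 = 0].

Definition odd_zero s b4 : Prop :=
  [/\ coef s true false false false b4 = 0, coef s false true false false b4 = 0,
      coef s false false true false b4 = 0 & coef s false false false true b4 = 0] /\
  [/\ coef s false true true true b4 = 0, coef s true false true true b4 = 0,
      coef s true true false true b4 = 0 & coef s true true true false b4 = 0].

(** Each factor ends by applying e_4 or f_4, so it adds to the coefficients with last bit [y]
    only. *)
Lemma coef_mixed_exp_same y a0 a1 a2 a3 d0 d1 d2 d3 s b0 b1 b2 b3 :
  coef (mixed_exp y a0 a1 a2 a3 d0 d1 d2 d3 s) b0 b1 b2 b3 (~~ y) = coef s b0 b1 b2 b3 (~~ y).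
Proof.
rewrite /coef mixed_exp_coefE // /transv_coef /=.
by case: y; rewrite /= !addr0.
Qed.

(** When p and r are the only even-degree coefficients feeding the change, e_i acts on p alone and
    f_i on r alone. The eight parameters then shift the eight odd-degree coefficients independently,
    and division by p and r clears them. *)
Lemma coef_mixed_exp_odd y a0 a1 a2 a3 d0 d1 d2 d3 s : even_mid_zero s (~~ y) ->
  let t := mixed_exp y a0 a1 a2 a3 d0 d1 d2 d3 s in
  let p := coef s false false false false (~~ y) in
  let r := coef s true true true true (~~ y) in
  [/\ coef t true false false false y = coef s true false false false y - a0 * p,
      coef t false true false false y = coef s false true false false y - a1 * p,
      coef t false false true false y = coef s false false true false y - a2 * p &
      coef t false false false true y = coef s false false false true y - a3 * p] /\
  [/\ coef t false true true true y = coef s false true true true y - d0 * r,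
      coef t true false true true y = coef s true false true true y + d1 * r,
      coef t true true false true y = coef s true true false true y - d2 * r &
      coef t true true true false y = coef s true true true false y + d3 * r].
Proof.
rewrite /even_mid_zero /coef => -[[e01 e02 e03] [e12 e13 e23]] /=.
by split; split; rewrite mixed_exp_coefE // /transv_coef /=;
  case: y e01 e02 e03 e12 e13 e23 => /= e01 e02 e03 e12 e13 e23;
  rewrite ?(e01, e02, e03, e12, e13, e23); ring.
Qed.

Lemma coef_mixed_exp_even y a0 a1 a2 a3 d0 d1 d2 d3 s : odd_zero s (~~ y) ->
  forall b0 b1 b2 b3, ~~ odd (count id [:: b0; b1; b2; b3]) ->
  coef (mixed_exp y a0 a1 a2 a3 d0 d1 d2 d3 s) b0 b1 b2 b3 y = coef s b0 b1 b2 b3 y.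
Proof.
rewrite /odd_zero /coef => -[[z0 z1 z2 z3] [z123 z023 z013 z012]] b0 b1 b2 b3 even_b.
rewrite mixed_exp_coefE // /transv_coef /=.
by case: y z0 z1 z2 z3 z123 z023 z013 z012 => /= z0 z1 z2 z3 z123 z023 z013 z012;
  case: b0 even_b; case: b1; case: b2; case: b3 => //= _;
  rewrite ?(z0, z1, z2, z3, z123, z023, z013, z012); ring.
Qed.

Lemma odd_zero_bivector_exp y c01 c02 c03 c12 c13 c23 s b4 : odd_zero s b4 ->
  odd_zero (bivector_exp y c01 c02 c03 c12 c13 c23 s) b4.
Proof.
rewrite /odd_zero /coef => -[[z0 z1 z2 z3] [z123 z023 z013 z012]].
by split; split; rewrite bivector_exp_coefE // /transv_coef /=; case: y => /=;
  rewrite ?(z0, z1, z2, z3, z123, z023, z013, z012); ring.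
Qed.

End BasisTransvections.

Lemma half_part_nf (k : fieldType) (s : spinor k) :
  odd_zero s false -> odd_zero s true -> even_mid_zero s false -> even_mid_zero s true ->
  half_part false s =
    even_nf (coef s false false false false false) (coef s true true true true false) /\
  half_part true s = odd_nf (coef s false false false false true) (coef s true true true true true).
Proof.
rewrite /odd_zero /even_mid_zero /coef.
move=> [[z0 z1 z2 z3] [z123 z023 z013 z012]] [[y0 y1 y2 y3] [y123 y023 y013 y012]].
move=> [[e01 e02 e03] [e12 e13 e23]] [[d01 d02 d03] [d12 d13 d23]].
by split; apply: spinor_bitsP => b0 b1 b2 b3 b4;
  rewrite [LHS]ffunE card_bits_set // ?even_nfE ?odd_nfE //;
  case: b0; case: b1; case: b2; case: b3; case: b4.
Qed.

(** * Diagonalization of the pencil *)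

Section Pencil.
Variable k : numClosedFieldType.
Implicit Types t : spinor k.

Local Notation Z s := (zero_locus (half_part false s) (half_part true s)).

Definition pfaffian (c01 c02 c03 c12 c13 c23 : k) : k :=
  c01 * c23 - c02 * c13 + c03 * c12.

Definition even_pfaffian t : k := pfaffian
  (coef t true true false false false) (coef t true false true false false)
  (coef t true false false true false) (coef t false true true false false)
  (coef t false true false true false) (coef t false false true true false).

(** The value at the even part of the quadratic form p r - Pf(x) on the even exterior algebra of E4,
    whose nonzero null vectors are the pure spinors of Spin_8. *)
Definition pencil_const t : k :=
  coef t false false false false false * coef t true true true true false - even_pfaffian t.

Definition pencil_disc t : k :=
  (coef t false false false false true * coef t true true true true false +
   coef t true true true true true * coef t false false false false false) ^+ 2 -
  4%:R * (coef t false false false false true * coef t true true true true true) *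
  pencil_const t.

(** The roots l of the quadratic form on l b + p. A nonzero discriminant makes them distinct, a
    nonzero constant term makes them nonzero, and the last equation is Vieta's formula for their
    sum. *)
Lemma pencil_roots (b0 b4 p0 p4 q : k) :
  b0 != 0 -> b4 != 0 -> p0 * p4 - q != 0 ->
  (b0 * p4 + b4 * p0) ^+ 2 - 4%:R * (b0 * b4) * (p0 * p4 - q) != 0 ->
  exists l1 l2 : k, [/\ l1 != l2, l1 != 0, l2 != 0,
    (l1 * b0 + p0) * (l1 * b4 + p4) = q /\ (l2 * b0 + p0) * (l2 * b4 + p4) = q &
    (l2 * b0 + p0) * b4 = - ((l1 * b4 + p4) * b0)].
Proof.
move=> b0n b4n Cn; set S := b0 * p4 + b4 * p0; set C := p0 * p4 - q.
set D := (X in X != 0 -> _) => Dn.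
pose d := sqrtC D; have d2 : d ^+ 2 = D by rewrite /d sqrtCK.
have dn : d != 0 by apply: contraNneq Dn; rewrite -d2 => ->; rewrite expr0n.
pose l1 := (- S + d) / (2%:R * (b0 * b4)); pose l2 := (- S - d) / (2%:R * (b0 * b4)).
have two : 2%:R != 0 :> k by rewrite pnatr_eq0.
have root l : (2%:R * (b0 * b4) * l + S) ^+ 2 = D -> (l * b0 + p0) * (l * b4 + p4) = q.
  move=> E; apply/eqP; rewrite -subr_eq0.
  have : 4%:R * (b0 * b4) * ((l * b0 + p0) * (l * b4 + p4) - q) = 0.
    have -> : 4%:R * (b0 * b4) * ((l * b0 + p0) * (l * b4 + p4) - q) =
      (2%:R * (b0 * b4) * l + S) ^+ 2 - D by rewrite /D /S /C; ring.
    by rewrite E subrr.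
  move/eqP; rewrite mulf_eq0 => /orP[|//].
  by rewrite !mulf_eq0 (negbTE b0n) (negbTE b4n) pnatr_eq0.
have E1 : 2%:R * (b0 * b4) * l1 + S = d by rewrite /l1; field; rewrite ?b0n ?b4n ?two.
have E2 : 2%:R * (b0 * b4) * l2 + S = - d by rewrite /l2; field; rewrite ?b0n ?b4n ?two.
have l12 : l1 * l2 * (4%:R * (b0 * b4) ^+ 2) = 4%:R * (b0 * b4) * C.
  have -> : 4%:R * (b0 * b4) * C = S ^+ 2 - d ^+ 2 by rewrite d2 /D; ring.
  by rewrite /l1 /l2; field; rewrite ?b0n ?b4n ?two.
have : l1 * l2 != 0.
  apply/eqP => l0; move/eqP: l12; rewrite l0 mul0r eq_sym !mulf_eq0.
  by rewrite pnatr_eq0 (negbTE b0n) (negbTE b4n) (negbTE Cn).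
rewrite mulf_eq0 negb_or => /andP[l1n l2n].
exists l1, l2; split=> //.
- apply: contraNneq dn => ll; have : d = - d by rewrite -[LHS]E1 ll.
  by move/eqP; rewrite -addr_eq0 -mulr2n mulrn_eq0.
- by split; apply: root; rewrite ?E1 ?E2 ?sqrrN.
- by rewrite /l1 /l2 /S; field; rewrite ?b0n ?b4n ?two.
Qed.

(* The members l1 b + p and l2 b + p of the pencil spanned by the even part p and
   by b, where e_4 b is the odd part, are pure spinors; the first exponential
   carries the one to a scalar, the second one the other to a multiple of
   e_0 e_1 e_2 e_3. *)
Lemma pencil_locus t : odd_zero t false -> even_mid_zero t true ->
  coef t false false false false true != 0 -> coef t true true true true true != 0 ->
  even_pfaffian t != 0 -> pencil_const t != 0 -> pencil_disc t != 0 ->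
  isomorphic (Z t) (Fl k 4).
Proof.
move=> oz [[z01 z02 z03] [z12 z13 z23]].
rewrite /pencil_disc /pencil_const /even_pfaffian.
set b0 := coef t false false false false true; set b4 := coef t true true true true true.
set p0 := coef t false false false false false; set p4 := coef t true true true true false.
set x01 := coef t true true false false false; set x02 := coef t true false true false false.
set x03 := coef t true false false true false; set x12 := coef t false true true false false.
set x13 := coef t false true false true false; set x23 := coef t false false true true false.
set q := pfaffian _ _ _ _ _ _ => b0n b4n qn Cn Dn.
have [l1 [l2 [ll l1n l2n [r1 r2] V]]] := pencil_roots b0n b4n Cn Dn.
set P1 := l1 * b0 + p0 in r1 V; set R1 := l1 * b4 + p4 in r1 V.
set P2 := l2 * b0 + p0 in r2 V; set R2 := l2 * b4 + p4 in r2.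
have P1n : P1 != 0 by apply: contraNneq qn; rewrite -r1 => ->; rewrite mul0r.
have ll0 : l1 - l2 != 0 by rewrite subr_eq0.
(* The member for [l1] has scalar [P1] and bivector x, as b contributes none. This exponential
   removes x, and nullity then leaves no top coefficient ([f1top]). *)
pose c x := - x / P1.
have := coef_bivector_exp_e (c x01) (c x02) (c x03) (c x12) (c x13) (c x23) t true.
have := coef_bivector_exp_e (c x01) (c x02) (c x03) (c x12) (c x13) (c x23) t false.
have := zero_locus_bivector_exp true (c x01) (c x02) (c x03) (c x12) (c x13) (c x23) t.
have := odd_zero_bivector_exp true (c x01) (c x02) (c x03) (c x12) (c x13) (c x23) oz.
move: (bivector_exp true _ _ _ _ _ _ t) => t1 oz1 iso1 /=.
rewrite z01 z02 z03 z12 z13 z23 -/b0 -/b4 -/x01 -/x02 -/x03 -/x12 -/x13 -/x23 -/p0 -/p4 !add0r.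
move=> [h0 [h01 h02 h03] [h12 h13 h23] h4] [g0 [g01 g02 g03] [g12 g13 g23] g4].
(* [R] and [m x] are the top and bivector coefficients of the second member after the first
   exponential. *)
pose R := R2 - 2%:R * q / P1 + q * P2 / P1 ^+ 2.
pose m x := x * (l1 - l2) * b0 / P1.
have f1 x : l1 * (c x * b0) + (x + c x * p0) = 0.
  by rewrite /c /P1; field; exact: P1n.
have f2 x : l2 * (c x * b0) + (x + c x * p0) = m x.
  by rewrite /c /m /P1; field; exact: P1n.
have f1top : l1 * coef t1 true true true true true + coef t1 true true true true false = 0.
  transitivity (R1 - q / P1); last by rewrite -r1 mulrC mulKf // subrr.
  by rewrite g4 h4 /c /q /pfaffian /R1 /P1; field; exact: P1n.
have f2top : l2 * coef t1 true true true true true + coef t1 true true true true false = R.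
  by rewrite g4 h4 /R /c /q /pfaffian /R2 /P2 /P1; field; exact: P1n.
(* R P1 is the polar form of the two null members. Their difference is (l1 - l2) b, so it is minus
   the value (l1 - l2)^2 b0 b4 of the quadratic form there. *)
have RE : R * P1 = - ((l1 - l2) ^+ 2 * (b0 * b4)).
  have -> : R * P1 = R2 * P1 - 2%:R * q + q / P1 * P2 by rewrite /R; field.
  have -> : q / P1 = R1 by rewrite -r1 mulrC mulKf.
  have -> : R2 * P1 - 2%:R * q + R1 * P2 = R2 * P1 - P1 * R1 - P2 * R2 + R1 * P2.
    by rewrite r1 r2; ring.
  by rewrite /R1 /R2 /P1 /P2; ring.
have Rn : R != 0.
  apply/eqP => R0; move/eqP: RE; rewrite R0 mul0r eq_sym oppr_eq0 !mulf_eq0.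
  by rewrite (negbTE ll0) (negbTE b0n) (negbTE b4n).
(* Cancels the bivector of the second member against its top coefficient [R]. The first member, now
   a scalar, is left unchanged. The order and signs of the arguments below undo the complementation
   of indices. *)
pose d x := m x / R.
have := coef_bivector_exp_f (d x23) (- d x13) (d x12) (d x03) (- d x02) (d x01) t1 true.
have := coef_bivector_exp_f (d x23) (- d x13) (d x12) (d x03) (- d x02) (d x01) t1 false.
have := zero_locus_bivector_exp false (d x23) (- d x13) (d x12) (d x03) (- d x02) (d x01) t1.
have := odd_zero_bivector_exp false (d x23) (- d x13) (d x12) (d x03) (- d x02) (d x01) oz1.
move: (bivector_exp false _ _ _ _ _ _ t1) => t2 oz2 iso2 /=.
rewrite g0 g01 g02 g03 g12 g13 g23 h0 h01 h02 h03 h12 h13 h23.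
move: f1top f2top.
set T4 := coef t1 true true true true true; set F4 := coef t1 true true true true false.
move=> f1top f2top.
move=> [j4 [j01 j02 j03] [j12 j13 j23] j0] [k4 [k01 k02 k03] [k12 k13 k23] k0].
(* A coordinate that vanishes on two distinct members vanishes on both halves. *)
have solve (T F : k) : l1 * T + F = 0 -> l2 * T + F = 0 -> T = 0 /\ F = 0.
  move=> e1 e2; suff T0 : T = 0 by move: e1; rewrite T0 mulr0 add0r.
  have /eqP : (l1 - l2) * T = 0.
    by rewrite -[RHS](subrr 0) -{1}e1 -e2; ring.
  by rewrite mulf_eq0 (negbTE ll0) => /eqP.
have dR x : d x * R = m x by rewrite /d divfK.
have mid x : c x * b0 - d x * T4 = 0 /\ x + c x * p0 - d x * F4 = 0.
  apply: solve.
    transitivity ((l1 * (c x * b0) + (x + c x * p0)) - d x * (l1 * T4 + F4)); first by ring.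
    by rewrite f1 f1top; ring.
  transitivity ((l2 * (c x * b0) + (x + c x * p0)) - d x * (l2 * T4 + F4)); first by ring.
  by rewrite f2 f2top dR subrr.
have midT x := proj1 (mid x); have midF x := proj2 (mid x).
have emt b : even_mid_zero t2 b.
  case: b; split; split; rewrite ?k01 ?k02 ?k03 ?k12 ?k13 ?k23 ?j01 ?j02 ?j03 ?j12 ?j13 ?j23;
    rewrite ?mulNr ?midT ?midF //.
set F0 := coef t2 false false false false false in j0.
set T0 := coef t2 false false false false true in k0.
have P1E : l1 * T0 + F0 = P1.
  rewrite k0 j0; transitivity (P1 - (d x23 * (l1 * (c x01 * b0) + (x01 + c x01 * p0)) -
     d x13 * (l1 * (c x02 * b0) + (x02 + c x02 * p0)) +
     d x12 * (l1 * (c x03 * b0) + (x03 + c x03 * p0)) +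
     d x03 * (l1 * (c x12 * b0) + (x12 + c x12 * p0)) -
     d x02 * (l1 * (c x13 * b0) + (x13 + c x13 * p0)) +
     d x01 * (l1 * (c x23 * b0) + (x23 + c x23 * p0))) +
     (d x23 * d x01 - d x13 * d x02 + d x12 * d x03) * (l1 * T4 + F4)).
    by rewrite /P1; ring.
  by rewrite !f1 f1top; ring.
(* The second member stays null; having nonzero top [R] and no bivector, it must lose its scalar.
   The Vieta relation [V] makes this explicit. *)
have P2E : l2 * T0 + F0 = 0.
  transitivity (P2 - (d x23 * (l2 * (c x01 * b0) + (x01 + c x01 * p0)) -
     d x13 * (l2 * (c x02 * b0) + (x02 + c x02 * p0)) +
     d x12 * (l2 * (c x03 * b0) + (x03 + c x03 * p0)) +
     d x03 * (l2 * (c x12 * b0) + (x12 + c x12 * p0)) -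
     d x02 * (l2 * (c x13 * b0) + (x13 + c x13 * p0)) +
     d x01 * (l2 * (c x23 * b0) + (x23 + c x23 * p0))) +
     (d x23 * d x01 - d x13 * d x02 + d x12 * d x03) * (l2 * T4 + F4)).
    by rewrite k0 j0 /P2; ring.
  rewrite !f2 f2top; transitivity (P2 - q * ((l1 - l2) * b0 / P1) ^+ 2 / R).
    by rewrite /d /m /q /pfaffian; field; rewrite Rn.
  have key : q * ((l1 - l2) * b0 / P1) ^+ 2 / R * b4 = - (R1 * b0).
    apply: (mulIf Rn); apply: (mulIf P1n); rewrite -[RHS]mulrA RE -r1.
    by field; rewrite P1n Rn.
  by apply: (mulIf b4n); rewrite mul0r mulrBl V key subrr.
have T0n : T0 != 0.
  apply: contraNneq P1n => T00; rewrite -P1E; move: P2E.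
  by rewrite T00 !mulr0 add0r => ->.
have F0E : F0 = - (l2 * T0) by apply/eqP; rewrite -addr_eq0 addrC P2E.
have F0n : F0 != 0 by rewrite F0E oppr_eq0 mulf_neq0.
have F4E : F4 = - (l1 * T4) by apply/eqP; rewrite -addr_eq0 addrC f1top.
have T4n : T4 != 0.
  by apply: contraNneq Rn => T40; rewrite -f2top F4E T40 !mulr0 oppr0 addr0.
have F4n : F4 != 0 by rewrite F4E oppr_eq0 mulf_neq0.
(* What remains is the part of the even half divisible by e_4. Clearing it divides by the scalar and
   top coefficients of the even half: these are nonzero now, but vanish at [base_spinor] before the
   diagonalization, so this step has to come last. *)
have := coef_mixed_exp_odd (y := true) (coef t2 true false false false true / F0)
  (coef t2 false true false false true / F0) (coef t2 false false true false true / F0)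
  (coef t2 false false false true true / F0) (coef t2 false true true true true / F4)
  (- (coef t2 true false true true true / F4)) (coef t2 true true false true true / F4)
  (- (coef t2 true true true false true / F4)) (emt false).
have := @coef_mixed_exp_same _ true (coef t2 true false false false true / F0)
  (coef t2 false true false false true / F0) (coef t2 false false true false true / F0)
  (coef t2 false false false true true / F0) (coef t2 false true true true true / F4)
  (- (coef t2 true false true true true / F4)) (coef t2 true true false true true / F4)
  (- (coef t2 true true true false true / F4)) t2.
have := coef_mixed_exp_even (y := true) (coef t2 true false false false true / F0)
  (coef t2 false true false false true / F0) (coef t2 false false true false true / F0)
  (coef t2 false false false true true / F0) (coef t2 false true true true true / F4)
  (- (coef t2 true false true true true / F4)) (coef t2 true true false true true / F4)
  (- (coef t2 true true true false true / F4)) oz2.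
have := zero_locus_mixed_exp true (coef t2 true false false false true / F0)
  (coef t2 false true false false true / F0) (coef t2 false false true false true / F0)
  (coef t2 false false false true true / F0) (coef t2 false true true true true / F4)
  (- (coef t2 true false true true true / F4)) (coef t2 true true false true true / F4)
  (- (coef t2 true true true false true / F4)) t2.
move: (mixed_exp true _ _ _ _ _ _ _ _ t2) => t3 iso3 ev3 same3 /=.
rewrite -/F0 j4 !mulNr !divfK // !subrr => odd3.
have [||||E1 E2] := @half_part_nf _ t3.
- by move: oz2; rewrite /odd_zero -!same3.
- exact: odd3.
- by move: (emt false); rewrite /even_mid_zero !same3.
- by move: (emt true); rewrite /even_mid_zero !ev3.
apply: isomorphic_trans iso1 _; apply: isomorphic_trans iso2 _.
apply: isomorphic_trans iso3 _; rewrite E1 E2.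
rewrite !same3 !ev3 // -/F0 -/T0 j4 k4.
apply: zero_locus_nf => //; first by rewrite pnatr_eq0.
have -> : F0 * T4 - T0 * F4 = (l1 - l2) * (T0 * T4) by rewrite F0E F4E; ring.
by rewrite !mulf_neq0.
Qed.

End Pencil.

(** * Generic spinors *)

Section Regular.
Variables (k : fieldType) (I : finType) (s0 : {ffun I -> k^o}).
Implicit Types (p q : {ffun I -> k^o} -> k) (Q : {ffun I -> k^o} -> Prop).

Definition poly_fun p : Prop :=
  exists P : {mpoly k[#|I|]}, forall s : {ffun I -> k^o}, P.@[fun i => s (enum_val i)] = p s.

Definition near_pt Q : Prop :=
  exists D, [/\ poly_fun D, D s0 != 0 & forall s, D s != 0 -> Q s].

(** The local ring at [s0]. Inverses are total, so p is compared with N / D only where D does not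
    vanish. *)
Definition regular_at p : Prop := exists N D,
  [/\ poly_fun N, poly_fun D, D s0 != 0 & forall s, D s != 0 -> p s = N s / D s].

Lemma near_pt_general Q : near_pt Q -> general Q.
Proof.
move=> [D [[P PD] D0 DQ]]; exists P; split; last by move=> s; rewrite PD; exact: DQ.
by apply: contraNneq D0 => P0; rewrite -PD P0 meval0.
Qed.

Lemma poly_fun_const (c : k) : poly_fun (fun=> c).
Proof. by exists c%:MP => s; rewrite mevalC. Qed.

Lemma poly_fun_coord i : poly_fun (fun s => s i).
Proof. by exists 'X_(enum_rank i) => s; rewrite mevalXU enum_rankK. Qed.

Lemma poly_funD p q : poly_fun p -> poly_fun q -> poly_fun (fun s => p s + q s).
Proof. by move=> [P Pp] [Q Qq]; exists (P + Q) => s; rewrite mevalD Pp Qq. Qed.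

Lemma poly_funM p q : poly_fun p -> poly_fun q -> poly_fun (fun s => p s * q s).
Proof. by move=> [P Pp] [Q Qq]; exists (P * Q) => s; rewrite mevalM Pp Qq. Qed.

Lemma near_pt_and Q Q' : near_pt Q -> near_pt Q' -> near_pt (fun s => Q s /\ Q' s).
Proof.
move=> [D [pD D0 DQ]] [D' [pD' D'0 DQ']]; exists (fun s => D s * D' s); split.
- exact: poly_funM.
- exact: mulf_neq0.
- by move=> s; rewrite mulf_eq0 negb_or => /andP[/DQ ? /DQ'].
Qed.

Lemma near_pt_impl Q Q' : (forall s, Q s -> Q' s) -> near_pt Q -> near_pt Q'.
Proof. by move=> QQ' [D [pD D0 DQ]]; exists D; split=> // s /DQ/QQ'. Qed.

Lemma regular_poly p : poly_fun p -> regular_at p.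
Proof.
move=> pp; exists p, (fun=> 1); split=> //; first exact: poly_fun_const.
  exact: oner_neq0.
by move=> s _; rewrite divr1.
Qed.

Lemma regular_const (c : k) : regular_at (fun=> c).
Proof. exact/regular_poly/poly_fun_const. Qed.

Lemma regular_coord i : regular_at (fun s => s i).
Proof. exact/regular_poly/poly_fun_coord. Qed.

Lemma regularD p q : regular_at p -> regular_at q -> regular_at (fun s => p s + q s).
Proof.
move=> [N [D [pN pD D0 E]]] [N' [D' [pN' pD' D'0 E']]].
exists (fun s => N s * D' s + N' s * D s), (fun s => D s * D' s); split.
- by apply: poly_funD; apply: poly_funM.
- exact: poly_funM.
- exact: mulf_neq0.
- by move=> s; rewrite mulf_eq0 negb_or => /andP[Ds D's]; rewrite E // E' // addf_div.
Qed.

Lemma regularM p q : regular_at p -> regular_at q -> regular_at (fun s => p s * q s).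
Proof.
move=> [N [D [pN pD D0 E]]] [N' [D' [pN' pD' D'0 E']]].
exists (fun s => N s * N' s), (fun s => D s * D' s); split.
- exact: poly_funM.
- exact: poly_funM.
- exact: mulf_neq0.
- by move=> s; rewrite mulf_eq0 negb_or => /andP[Ds D's]; rewrite E // E' // mulf_div.
Qed.

Lemma regularN p : regular_at p -> regular_at (fun s => - p s).
Proof.
move=> /(regularM (regular_const (-1))) [N [D [pN pD D0 E]]].
by exists N, D; split=> // s Ds; rewrite -E // mulN1r.
Qed.

Lemma regularV p : regular_at p -> p s0 != 0 -> regular_at (fun s => (p s)^-1).
Proof.
move=> [N [D [pN pD D0 E]]] p0.
have N0 : N s0 != 0 by apply: contraNneq p0 => N0; rewrite E // N0 mul0r.
(* The inverse is D / N. The extra factor D keeps the zeros of D excluded, where nothing is known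
   about p. *)
exists (fun s => D s * D s), (fun s => N s * D s); split.
- exact: poly_funM.
- exact: poly_funM.
- exact: mulf_neq0.
- move=> s; rewrite mulf_eq0 negb_or => /andP[Ns Ds]; rewrite E // invf_div.
  by rewrite -mulf_div divff // mulr1.
Qed.

Lemma regular_near p : regular_at p -> p s0 != 0 -> near_pt (fun s => p s != 0).
Proof.
move=> [N [D [pN pD D0 E]]] p0; exists (fun s => N s * D s); split.
- exact: poly_funM.
- by rewrite mulf_neq0 //; apply: contraNneq p0 => N0; rewrite E // N0 mul0r.
- move=> s; rewrite mulf_eq0 negb_or => /andP[Ns Ds].
  by rewrite E // mulf_neq0 // invr_eq0.
Qed.

End Regular.

Section Generic.
Variable k : numClosedFieldType.
Implicit Types (s t u : spinor k).

Local Notation Z s := (zero_locus (half_part false s) (half_part true s)).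

(* e_4 + e_0 e_1 e_2 e_3 e_4 + e_0 e_1 + e_2 e_3 *)
Definition base_spinor : spinor k := [ffun J =>
  if J \in [:: bits_set [:: false; false; false; false; true];
               bits_set [:: true; true; true; true; true];
               bits_set [:: true; true; false; false; false];
               bits_set [:: false; false; true; true; false]] then 1 else 0].

Lemma coef_base_spinor b0 b1 b2 b3 b4 : coef base_spinor b0 b1 b2 b3 b4 =
  if [:: b0; b1; b2; b3; b4] \in
    [:: [:: false; false; false; false; true]; [:: true; true; true; true; true];
        [:: true; true; false; false; false]; [:: false; false; true; true; false]]
  then 1 else 0.
Proof. by rewrite /coef ffunE !in_cons !bits_set_inj. Qed.

Local Notation regular := (regular_at base_spinor).

Definition regular_map (phi : spinor k -> spinor k) : Prop :=
  forall J, regular (fun s => phi s J).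

Lemma regular_basis_transv c y i y' j phi : (i < 5)%N -> (j < 5)%N ->
  regular c -> regular_map phi ->
  regular_map (fun s => basis_transv (c s) y i y' j (phi s)).
Proof.
move=> i5 j5 rc rphi J; have [b0 [b1 [b2 [b3 [b4 ->]]]]] := bits_setP J.
set b := [:: _; _; _; _; _].
have -> : (fun s => basis_transv (c s) y i y' j (phi s) (bits_set b)) =
    (fun s => phi s (bits_set b) +
  if nth false b i == y then
    let b' := set_nth false b i (~~ y) in
    if nth false b' j == y' then
      (-1) ^+ (count id (take i b) + count id (take j b')) *
      (c s * phi s (bits_set (set_nth false b' j (~~ y'))))
    else 0
  else 0).
  by apply/funext => s; rewrite basis_transvE.
apply: regularD; first exact: rphi.
case: (nth false b i == y) => /=; last exact: regular_const.
case: (nth false (set_nth _ _ _ _) j == y') => /=; last exact: regular_const.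
apply: (regularM (regular_const _ _) (regularM rc (rphi _))).
Qed.

Lemma bivector_exp0 y s : bivector_exp y 0 0 0 0 0 0 s = s.
Proof. by rewrite /bivector_exp !basis_transv0. Qed.

Lemma mixed_exp0 y s : mixed_exp y 0 0 0 0 0 0 0 0 s = s.
Proof. by rewrite /mixed_exp !basis_transv0. Qed.

(** Uses the coefficient of e_4 to clear those of the e_i e_j e_4, which brings the odd half to the
    shape required by [coef_mixed_exp_odd]. *)
Definition clear_bivector s : spinor k :=
  let p := coef s false false false false true in
  bivector_exp true (- coef s true true false false true / p)
    (- coef s true false true false true / p) (- coef s true false false true true / p)
    (- coef s false true true false true / p) (- coef s false true false true true / p)
    (- coef s false false true true true / p) s.

(** The exponentials with f_4 carry the terms in e_4 and e_0 e_1 e_2 e_3 e_4 to degrees 1 and 3 in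
    E4, where they cancel the rest of the odd half. *)
Definition clear_odd s : spinor k :=
  let p := coef s false false false false true in
  let r := coef s true true true true true in
  mixed_exp false (coef s true false false false false / p)
    (coef s false true false false false / p) (coef s false false true false false / p)
    (coef s false false false true false / p) (coef s false true true true false / r)
    (- (coef s true false true true false / r)) (coef s true true false true false / r)
    (- (coef s true true true false false / r)) s.

Lemma clear_bivectorE s : coef s false false false false true != 0 ->
  even_mid_zero (clear_bivector s) true /\
  coef (clear_bivector s) false false false false true = coef s false false false false true.
Proof.
move=> s4; rewrite /clear_bivector /=; set p := coef s false false false false true.
have [g0 [g01 g02 g03] [g12 g13 g23] _] := coef_bivector_exp_e
  (- coef s true true false false true / p)
    (- coef s true false true false true / p) (- coef s true false false true true / p)
    (- coef s false true true false true / p) (- coef s false true false true true / p)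
    (- coef s false false true true true / p) s true.
split; last exact: g0.
by split; split; rewrite ?g01 ?g02 ?g03 ?g12 ?g13 ?g23 divfK // subrr.
Qed.

Lemma clear_oddE s : even_mid_zero s true ->
  coef s false false false false true != 0 -> coef s true true true true true != 0 ->
  [/\ odd_zero (clear_odd s) false, even_mid_zero (clear_odd s) true,
      coef (clear_odd s) false false false false true != 0 &
      coef (clear_odd s) true true true true true != 0].
Proof.
move=> ez s4 s5; have same := @coef_mixed_exp_same k false.
split; try by rewrite /clear_odd same.
- have := coef_mixed_exp_odd (y := false) _ _ _ _ _ _ _ _ ez.
  move=> /(_ (coef s true false false false false / coef s false false false false true)
    (coef s false true false false false / coef s false false false false true)
    (coef s false false true false false / coef s false false false false true)
    (coef s false false false true false / coef s false false false false true)
    (coef s false true true true false / coef s true true true true true)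
    (- (coef s true false true true false / coef s true true true true true))
    (coef s true true false true false / coef s true true true true true)
    (- (coef s true true true false false / coef s true true true true true))).
  by rewrite /= !mulNr !divfK // !subrr.
- by move: ez; rewrite /even_mid_zero /clear_odd !same.
Qed.

(** Everything to be cleared is already zero there. As the reduction fixes [base_spinor], the
    denominators and conditions of later steps can be evaluated at that same point. *)
Lemma clear_bivector_base : clear_bivector base_spinor = base_spinor.
Proof. by rewrite /clear_bivector /= !coef_base_spinor /= oppr0 !mul0r bivector_exp0. Qed.

Lemma clear_odd_base : clear_odd base_spinor = base_spinor.
Proof. by rewrite /clear_odd /= !coef_base_spinor /= !mul0r oppr0 mixed_exp0. Qed.

Lemma regular_clear_bivector : regular_map clear_bivector.
Proof.
have rp : regular (fun s => (coef s false false false false true)^-1).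
  apply: regularV; first exact: regular_coord.
  by rewrite coef_base_spinor /= oner_neq0.
have rc b0 b1 b2 b3 b4 :
    regular (fun s => - coef s b0 b1 b2 b3 b4 / coef s false false false false true).
  by apply: regularM rp; apply: regularN; exact: regular_coord.
by do 6 apply: regular_basis_transv => //; move=> J; exact: regular_coord.
Qed.

Lemma regular_clear_odd phi : regular_map phi -> phi base_spinor = base_spinor ->
  regular_map (fun s => clear_odd (phi s)).
Proof.
move=> rphi phi0.
have rp : regular (fun s => (coef (phi s) false false false false true)^-1).
  apply: regularV; first exact: rphi.
  by rewrite phi0 coef_base_spinor /= oner_neq0.
have rr : regular (fun s => (coef (phi s) true true true true true)^-1).
  apply: regularV; first exact: rphi.
  by rewrite phi0 coef_base_spinor /= oner_neq0.
have rcp b0 b1 b2 b3 b4 :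
    regular (fun s => coef (phi s) b0 b1 b2 b3 b4 / coef (phi s) false false false false true).
  by apply: regularM rp; exact: rphi.
have rcr b0 b1 b2 b3 b4 :
    regular (fun s => coef (phi s) b0 b1 b2 b3 b4 / coef (phi s) true true true true true).
  by apply: regularM rr; exact: rphi.
have rcrN b0 b1 b2 b3 b4 :
    regular (fun s => - (coef (phi s) b0 b1 b2 b3 b4 / coef (phi s) true true true true true)).
  by apply: regularN; exact: rcr.
by do 8 apply: regular_basis_transv => //.
Qed.

Theorem general_locus : general (fun s : spinor k => isomorphic (Z s) (Fl k 4)).
Proof.
apply: (@near_pt_general _ _ base_spinor).
pose phi s := clear_odd (clear_bivector s).
have phi0 : phi base_spinor = base_spinor.
  by rewrite /phi clear_bivector_base clear_odd_base.
have rphi : regular_map phi.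
  by apply: regular_clear_odd; [exact: regular_clear_bivector | exact: clear_bivector_base].
have rco b0 b1 b2 b3 b4 : regular (fun s => coef (phi s) b0 b1 b2 b3 b4) by exact: rphi.
have rpf : regular (fun s => even_pfaffian (phi s)).
  by rewrite /even_pfaffian /pfaffian; apply: regularD; [apply: regularD|];
    [|apply: regularN|]; apply: regularM.
have rconst : regular (fun s => pencil_const (phi s)).
  by rewrite /pencil_const; apply: regularD; [apply: regularM | apply: regularN].
have rdisc : regular (fun s => pencil_disc (phi s)).
  rewrite /pencil_disc; apply: regularD.
    by under eq_fun do rewrite expr2; apply: regularM; apply: regularD; apply: regularM.
  apply: regularN; apply: regularM => //; apply: regularM; first exact: regular_const.
  by apply: regularM.
have n4 : near_pt base_spinor (fun s : spinor k => coef s false false false false true != 0).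
  apply: regular_near; first exact: regular_coord.
  by rewrite coef_base_spinor /= oner_neq0.
have n5 : near_pt base_spinor (fun s => coef (clear_bivector s) true true true true true != 0).
  apply: regular_near; first exact: regular_clear_bivector.
  by rewrite clear_bivector_base coef_base_spinor /= oner_neq0.
(* At this point b = 1 + e_0 e_1 e_2 e_3 and p = e_0 e_1 + e_2 e_3, so the quadratic form on l b + p
   is l^2 - 1. *)
have pf0 : even_pfaffian base_spinor = 1.
  by rewrite /even_pfaffian /pfaffian !coef_base_spinor /=; ring.
have const0 : pencil_const base_spinor = -1.
  by rewrite /pencil_const pf0 !coef_base_spinor /=; ring.
have disc0 : pencil_disc base_spinor = 4%:R.
  by rewrite /pencil_disc const0 !coef_base_spinor /=; ring.
have npf : near_pt base_spinor (fun s => even_pfaffian (phi s) != 0).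
  by apply: regular_near => //; rewrite phi0 pf0 oner_neq0.
have nconst : near_pt base_spinor (fun s => pencil_const (phi s) != 0).
  by apply: regular_near => //; rewrite phi0 const0 oppr_eq0 oner_neq0.
have ndisc : near_pt base_spinor (fun s => pencil_disc (phi s) != 0).
  by apply: regular_near => //; rewrite phi0 disc0 pnatr_eq0.
have := near_pt_and (near_pt_and n4 n5) (near_pt_and npf (near_pt_and nconst ndisc)).
apply: near_pt_impl => s [[s4 s5] [pfn [constn discn]]].
have [ez cs4] := clear_bivectorE s4; rewrite -cs4 in s4.
have [oz ez' s4' s5'] := clear_oddE ez s4 s5.
apply: isomorphic_trans (zero_locus_bivector_exp _ _ _ _ _ _ _ _) _.
apply: isomorphic_trans (zero_locus_mixed_exp _ _ _ _ _ _ _ _ _ _) _.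
exact: (pencil_locus oz ez' s4' s5' pfn constn discn).
Qed.

End Generic.

Theorem proposition16 (R : realType) :
  general (fun s : spinor R[i] =>
    isomorphic (zero_locus (half_part false s) (half_part true s)) (Fl R[i] 4)).
Proof. exact: general_locus. Qed.
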